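(* For every function $c=c(k)$ there exists a function $c'=c'(k')$ such that $$\lim_{k\to\infty}\sigma\big((k,c)\text{-Sparse-}\oplus\text{CNF-SAT}/n\big)\le\lim_{k'\to\infty}\sigma\big((k',c')\text{-Sparse-}\oplus\text{Hitting Set}/n\big).$$
   Context: For a problem $\Pi$ with input size $m$ and parameter $n$, $\sigma(\Pi/n)$ is the infimum of all $\epsilon>0$ such that $\Pi$ has a randomized algorithm with error probability at most $1/3$ running in time $2^{\epsilon n}\mathrm{poly}(m)$. $(k,c)$-Sparse-$\oplus$CNF-SAT: given a CNF formula on $n$ variables with at most $cn$ clauses of size at most $k$, decide whether the number of satisfying assignments is odd. $(k,c)$-Sparse-$\oplus$Hitting Set: given $\mathcal F\subseteq 2^U$, $|U|=n$, $|\mathcal F|\le cn$, sets of size at most $k$, decide whether the number of $H\subseteq U$ with $H\cap S\ne\emptyset$ for all $S\in\mathcal F$ is odd. Here $c$ stands for $c(k)$ (resp. $c'(k')$). *)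

(* Defs.v *)
From Corelib Require Import BinNums.
From HB Require Import structures.
From mathcomp Require Import all_boot all_order all_algebra.
From mathcomp Require Import all_classical all_reals all_analysis.

Set Implicit Arguments.
Unset Strict Implicit.
Unset Printing Implicit Defensive.

Import Order.TTheory GRing.Theory Num.Theory.

(** * Randomized algorithms

    Algorithms are programs of the WHILE language over binary trees (pure LISP
    data), extended with a fair coin.  A program is fixed, so its expressions
    have bounded size and every assignment, coin flip or test is charged one
    step.  Trees are shared and immutable: on inputs of size m, T steps take
    O(m + T) steps on a RAM with words of O(log (m + T)) bits, and conversely
    the simulation of such a RAM is slower only by a factor
    polylog (m + T) (keep the memory in a balanced tree).  So the two models
    yield the same infimum of the eps in the bounds 2^(eps n) poly(m). *)

Inductive tree : Type := Leaf | Node of tree & tree.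

Fixpoint tree_size (t : tree) : nat :=
  if t is Node l r then (tree_size l + tree_size r).+1 else 1.

Definition is_node (t : tree) : bool := if t is Node _ _ then true else false.

Definition bool_tree (b : bool) : tree := if b then Node Leaf Leaf else Leaf.

Inductive expr : Type :=
| Var of nat
| Nil
| Cons of expr & expr
| Hd of expr
| Tl of expr.

Inductive cmd : Type :=
| Skip
| Assign of nat & expr
| Flip of nat
| Seq of cmd & cmd
| If of expr & cmd & cmd
| While of expr & cmd.

Definition store : Type := nat -> tree.

Definition update (s : store) (x : nat) (t : tree) : store :=
  fun y => if y == x then t else s y.

Fixpoint eval (s : store) (e : expr) : tree :=
  match e with
  | Var x => s x
  | Nil => Leaf
  | Cons e1 e2 => Node (eval s e1) (eval s e2)
  | Hd e1 => if eval s e1 is Node l _ then l else Leaf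
  | Tl e1 => if eval s e1 is Node _ r then r else Leaf
  end.

(** [exec p s r s' r' t]: started in store [s] with coins [r], the program [p]
    halts after [t] steps in store [s'], the coins [r'] being left unused.
    A program that runs out of coins is stuck. *)
Inductive exec : cmd -> store -> seq bool -> store -> seq bool -> nat -> Prop :=
| exec_Skip s r : exec Skip s r s r 0
| exec_Assign x e s r : exec (Assign x e) s r (update s x (eval s e)) r 1
| exec_Flip x b s r : exec (Flip x) s (b :: r) (update s x (bool_tree b)) r 1
| exec_Seq p q s1 s2 s3 r1 r2 r3 t u :
    exec p s1 r1 s2 r2 t -> exec q s2 r2 s3 r3 u ->
    exec (Seq p q) s1 r1 s3 r3 (t + u)
| exec_If e p q s1 s2 r1 r2 t :
    exec (if is_node (eval s1 e) then p else q) s1 r1 s2 r2 t ->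
    exec (If e p q) s1 r1 s2 r2 t.+1
| exec_While_stop e p s r :
    ~~ is_node (eval s e) -> exec (While e p) s r s r 1
| exec_While_loop e p s1 s2 s3 r1 r2 r3 t u :
    is_node (eval s1 e) ->
    exec p s1 r1 s2 r2 t -> exec (While e p) s2 r2 s3 r3 u ->
    exec (While e p) s1 r1 s3 r3 (t + u).+1.

Definition init (w : tree) : store := update (fun _ => Leaf) 0 w.

(** Input and output are in variable 0; the output [Leaf] means "no". *)
Definition runs_within (p : cmd) (w : tree) (T : nat) (r : seq bool) (b : bool)
    : Prop :=
  exists s r' t, [/\ exec p (init w) r s r' t, t <= T & is_node (s 0) = b].

(** For every outcome of the coins, [p] halts on [w] within [T] steps, and its
    output [out] differs from [b] with probability at most 1/3.  At most one
    coin is used per step, so [T] uniform coins suffice. *)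
Definition decides_within (p : cmd) (w : tree) (T : nat) (b : bool) : Prop :=
  exists out : T.-tuple bool -> bool,
    (forall r : T.-tuple bool, runs_within p w T r (out r)) /\
    3 * #|[pred r | out r != b]| <= 2 ^ T.

(** * Parameterized problems and the exponent sigma *)

(** An algorithm for a problem has to be correct (and fast) only on the inputs
    that encode an instance of it. *)
Record problem : Type := Problem {
  instance : Type;
  parameter : instance -> nat;
  encodes : instance -> tree -> Prop;
  answer : instance -> bool }.

Definition solvable_with_exponent (R : realType) (Pi : problem) (eps : R)
    : Prop :=
  exists (p : cmd) (C d : nat), forall (I : instance Pi) (w : tree),
    encodes I w ->
    exists T : nat,
      (T%:R <= 2 `^ (eps * (parameter I)%:R) * (C * tree_size w ^ d)%N%:R)%R /\
      decides_within p w T (answer I).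

Definition sigma (R : realType) (Pi : problem) : \bar R :=
  ereal_inf [set (eps%:E)%E | eps in
    [set eps : R | (0 < eps)%R /\ solvable_with_exponent Pi eps]]%classic.

(** * Encoding of set families *)

Definition list_tree (T : Type) (f : T -> tree) (s : seq T) : tree :=
  foldr (fun x t => Node (f x) t) Leaf s.

(** Binary, least significant bit first, without leading zeros. *)
Fixpoint pos_tree (q : positive) : tree :=
  match q with
  | xH => Node (bool_tree true) Leaf
  | xO q' => Node (bool_tree false) (pos_tree q')
  | xI q' => Node (bool_tree true) (pos_tree q')
  end.

Definition nat_tree (n : nat) : tree :=
  if bin_of_nat n is Npos q then pos_tree q else Leaf.

(** The sets of the family, and the elements of each set, may be listed in any
    order and with repetitions. *)
Definition encodes_family (T : finType) (f : T -> tree) (n : nat)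
    (F : {set {set T}}) (w : tree) : Prop :=
  exists L : seq (seq T),
    F = [set:: [seq [set:: s] | s <- L]] /\
    w = Node (nat_tree n) (list_tree (list_tree f) L).

(** [c] is the value of the density function at [k]. *)
Definition sparse (R : realType) (T : finType) (n k : nat) (c : R)
    (F : {set {set T}}) : Prop :=
  (#|F|%:R <= c * n%:R)%R /\ (forall S : {set T}, S \in F -> #|S| <= k).

(** * The two problems *)

(** The literal [(i, true)] is the variable [i], [(i, false)] its negation. *)
Definition cnf (n : nat) : Type := {set {set 'I_n * bool}}.

Definition satisfies (n : nat) (a : {ffun 'I_n -> bool}) (F : cnf n) : bool :=
  [forall C in F, [exists l in C, a l.1 == l.2]].

Definition literal_tree (n : nat) (l : 'I_n * bool) : tree :=
  Node (bool_tree l.2) (nat_tree l.1).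

Definition sparse_parity_cnf_sat (R : realType) (k : nat) (c : R) : problem :=
  {| instance := {n : nat & {F : cnf n | sparse n k c F}};
     parameter := fun I => tag I;
     encodes := fun I =>
       encodes_family (@literal_tree (tag I)) (tag I) (sval (tagged I));
     answer := fun I =>
       odd #|[pred a | satisfies a (sval (tagged I))]| |}.

Definition hits (n : nat) (H : {set 'I_n}) (F : {set {set 'I_n}}) : bool :=
  [forall S in F, H :&: S != finset.set0].

Definition sparse_parity_hitting_set (R : realType) (k : nat) (c : R)
    : problem :=
  {| instance := {n : nat & {F : {set {set 'I_n}} | sparse n k c F}};
     parameter := fun I => tag I;
     encodes := fun I =>
       encodes_family (fun i : 'I_(tag I) => nat_tree i) (tag I)
         (sval (tagged I));
     answer := fun I => odd #|[pred H | hits H (sval (tagged I))]| |}.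

(* Main.v *)
(** Split the variables into blocks of 2^b variables and encode the assignments of
    a block as an antichain of subsets of p = 2^b + b + 2 elements, all of the same
    size.  Every clause then becomes boundedly many hitting constraints: H misses
    the union of the complements of codewords A_1, ..., A_l exactly if H encodes
    A_i in the i-th block, for every i.  That H contains a codeword in each block
    is a monotone condition, and so a conjunction of hitting constraints.  That it
    is not larger than a codeword is the negation of a monotone condition f; one
    more element e per block, added to the sets that express f, makes the number
    of completions 1 + f, which is odd exactly if f fails.

    This uses 2^b + b + 3 elements per 2^b variables, so the exponent grows by a
    factor that tends to 1.  The program works in time polynomial in the length of
    the input even if that is logarithmic in n, because it emits the sets of a
    block once for every occurrence of one of its variables. *)

From mathcomp Require Import all_boot all_order all_algebra.
From mathcomp Require Import all_classical all_reals all_analysis.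
From mathcomp Require Import fintype finset zify.
Require Import Defs.

Set Implicit Arguments.
Unset Strict Implicit.
Unset Printing Implicit Defensive.

Import Order.TTheory GRing.Theory Num.Theory numFieldNormedType.Exports.

(** * Polynomial-time functions on trees *)

(** Equal size makes the codewords an antichain, so a block that contains one codeword and lies
    inside another equals both: inclusions, the only thing hitting constraints can speak about, are
    enough to identify a word. No fixed [b] suffices, since the factor [(2 ^ b + b + 3) / 2 ^ b]
    exceeds 1 for each of them. Hence [b = k] is taken, at the price of set sizes and densities that
    grow quickly with [k]. This is harmless, because [c'] may be chosen: it only has to be large
    enough at one suitable [k'] for each [k]. A monotone [c'] makes the exponents of the hitting set
    problems monotone in [k'], so their limit exists and, being the supremum, dominates the exponent
    at that [k'] however far [k'] is from [k]. *)

Definition thd (t : tree) : tree := if t is Node l _ then l else Leaf.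
Definition ttl (t : tree) : tree := if t is Node _ r then r else Leaf.

Lemma tree_size_gt0 t : 0 < tree_size t.
Proof. by case: t. Qed.

Lemma size_thd t : tree_size (thd t) <= tree_size t.
Proof. by case: t => //= l r; lia. Qed.

Lemma size_ttl t : tree_size (ttl t) <= tree_size t.
Proof. by case: t => //= l r; lia. Qed.

Definition poly_bounded (T : tree -> nat) : Prop :=
  exists C d, forall x, T x <= C * tree_size x ^ d.

Lemma poly_bounded_le T U :
  (forall x, T x <= U x) -> poly_bounded U -> poly_bounded T.
Proof. by move=> leTU [C [d leU]]; exists C, d => x; apply: leq_trans (leU x). Qed.

Lemma poly_bounded_const c : poly_bounded (fun=> c).
Proof. by exists c, 0 => x; rewrite expn0 muln1. Qed.

Lemma poly_bounded_size : poly_bounded tree_size.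
Proof. by exists 1, 1 => x; rewrite mul1n expn1. Qed.

Lemma leq_pexp2 n d e : 0 < n -> n ^ d <= n ^ (d + e).
Proof. by move=> n_gt0; rewrite leq_pexp2l ?leq_addr. Qed.

Lemma leq_expl d m n : m <= n -> m ^ d <= n ^ d.
Proof. by case: d => // d le_mn; rewrite leq_exp2r. Qed.

Lemma poly_bounded_add T U :
  poly_bounded T -> poly_bounded U -> poly_bounded (fun x => T x + U x).
Proof.
move=> [C [d leT]] [D [e leU]]; exists (C + D), (d + e) => x.
rewrite mulnDl leq_add //.
  by rewrite (leq_trans (leT x)) // leq_mul2l leq_pexp2 ?orbT ?tree_size_gt0.
by rewrite (leq_trans (leU x)) // leq_mul2l addnC leq_pexp2 ?orbT ?tree_size_gt0.
Qed.

Lemma poly_bounded_mul T U :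
  poly_bounded T -> poly_bounded U -> poly_bounded (fun x => T x * U x).
Proof.
move=> [C [d leT]] [D [e leU]]; exists (C * D), (d + e) => x.
by rewrite expnD mulnACA leq_mul.
Qed.

Lemma poly_bounded_exp T d :
  poly_bounded T -> poly_bounded (fun x => T x ^ d).
Proof.
move=> bT; elim: d => [|d IHd]; first exact: poly_bounded_const.
apply: poly_bounded_le (poly_bounded_mul bT IHd) => x; exact: eq_leq (expnS _ _).
Qed.

Lemma poly_bounded_comp T f :
  poly_bounded T -> poly_bounded (fun x => tree_size (f x)) ->
  poly_bounded (fun x => T (f x)).
Proof.
move=> [C [d leT]] bf; apply: poly_bounded_le (fun x => leT (f x)) _.
exact: poly_bounded_mul (poly_bounded_const C) (poly_bounded_exp d bf).
Qed.

Lemma size_thd_bounded : poly_bounded (fun x => tree_size (thd x)).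
Proof. exact: poly_bounded_le size_thd poly_bounded_size. Qed.

Lemma size_ttl_bounded : poly_bounded (fun x => tree_size (ttl x)).
Proof. exact: poly_bounded_le size_ttl poly_bounded_size. Qed.

Definition implements (p : cmd) (v w : nat) (f : tree -> tree)
    (T : tree -> nat) : Prop :=
  forall (s : store) r x, s v = x -> exists (s' : store) t,
    [/\ exec p s r s' r t, t <= T x, s' v = f x &
        forall y, (y < v) || (v + w <= y) -> s' y = s y].

Definition computable (f : tree -> tree) (T : tree -> nat) : Prop :=
  exists w, forall v, exists p, implements p v w f T.

(** Building a tree takes one step whatever its size, so that the number of
    steps does not bound the size of the result. *)
Definition FP (f : tree -> tree) : Prop :=
  exists T, [/\ computable f T, poly_bounded T &
                poly_bounded (fun x => tree_size (f x))].

Lemma update_same (s : store) x t : update s x t x = t.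
Proof. by rewrite /update eqxx. Qed.

Lemma update_other (s : store) x t y : y != x -> update s x t y = s y.
Proof. by rewrite /update => /negPf->. Qed.

Lemma FP_expr (e : nat -> expr) f :
  (forall (s : store) v, eval s (e v) = f (s v)) ->
  poly_bounded (fun x => tree_size (f x)) -> FP f.
Proof.
move=> ef bf; exists (fun=> 1); split=> //; last exact: poly_bounded_const.
exists 1 => v; exists (Assign v (e v)) => s r x sv.
exists (update s v (eval s (e v))), 1; split=> //; first exact: exec_Assign.
  by rewrite update_same ef sv.
by move=> y yv; rewrite update_other //; apply: contraL yv => /eqP->; lia.
Qed.

Lemma FP_id : FP id.
Proof. exact: (@FP_expr Var) poly_bounded_size. Qed.

Lemma FP_const c : FP (fun=> c).
Proof.
pose e := fix e t := if t is Node l r then Cons (e l) (e r) else Nil.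
apply: (@FP_expr (fun=> e c)); last exact: poly_bounded_const.
by move=> s _; elim: c => //= l -> r ->.
Qed.

Lemma FP_thd : FP thd.
Proof. exact: (@FP_expr (fun v => Hd (Var v))) size_thd_bounded. Qed.

Lemma FP_ttl : FP ttl.
Proof. exact: (@FP_expr (fun v => Tl (Var v))) size_ttl_bounded. Qed.

Lemma FP_comp g f : FP g -> FP f -> FP (fun x => g (f x)).
Proof.
move=> [Tg [[wg cg] bTg bg]] [Tf [[wf cf] bTf bf]].
exists (fun x => Tf x + Tg (f x)); split; last exact: poly_bounded_comp bg bf.
  exists (wg + wf) => v; have [pf cpf] := cf v; have [pg cpg] := cg v.
  exists (Seq pf pg) => s r x sv.
  have [s1 [t1 [ex1 le1 v1 fr1]]] := cpf s r x sv.
  have [s2 [t2 [ex2 le2 v2 fr2]]] := cpg s1 r _ v1.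
  exists s2, (t1 + t2); split; first exact: exec_Seq ex1 ex2.
  - by rewrite leq_add.
  - by rewrite v2.
  - by move=> y yv; rewrite fr2 ?fr1 //; lia.
exact: poly_bounded_add bTf (poly_bounded_comp bTg bf).
Qed.

Lemma FP_Node f g : FP f -> FP g -> FP (fun x => Node (f x) (g x)).
Proof.
move=> [Tf [[wf cf] bTf bf]] [Tg [[wg cg] bTg bg]].
exists (fun x => Tf x + Tg x + 3); split.
- exists (wf + wg + 3) => v; have [pf cpf] := cf v.+1; have [pg cpg] := cg v.+2.
  (* The input survives in [v] and the value of [f] in [v.+1], because [pg] works from [v.+2] on; it
     may overwrite whatever else [pf] left behind. *)
  exists (Seq (Assign v.+1 (Var v)) (Seq pf (Seq (Assign v.+2 (Var v))
    (Seq pg (Assign v (Cons (Var v.+1) (Var v.+2))))))) => s r x sv.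
  set s1 := update s v.+1 x.
  have [s2 [t2 [ex2 le2 v2 fr2]]] := cpf s1 r x (update_same _ _ _).
  have s2v : s2 v = x by rewrite fr2 /s1 ?update_other //; lia.
  set s3 := update s2 v.+2 x.
  have [s4 [t4 [ex4 le4 v4 fr4]]] := cpg s3 r x (update_same _ _ _).
  exists (update s4 v (Node (s4 v.+1) (s4 v.+2))), (1 + (t2 + (1 + (t4 + 1)))).
  split.
  + apply: exec_Seq (exec_Assign _ _ _ _) _; rewrite /= sv.
    apply: exec_Seq ex2 _; apply: exec_Seq (exec_Assign _ _ _ _) _.
    by rewrite /= s2v; apply: exec_Seq ex4 _; exact: exec_Assign.
  + by move: le2 le4; lia.
  + rewrite update_same v4 fr4; last by lia.
    by rewrite /s3 update_other ?v2 //; lia.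
  + move=> y yv; rewrite update_other; last by lia.
    rewrite fr4; last by lia.
    rewrite /s3 update_other; last by lia.
    by rewrite fr2 /s1 ?update_other //; lia.
- by apply: poly_bounded_add (poly_bounded_const _); exact: poly_bounded_add.
- apply: poly_bounded_le (poly_bounded_add (poly_bounded_add bf bg) (poly_bounded_const 1)).
  by move=> x /=; lia.
Qed.

Lemma FP_if c f g : FP c -> FP f -> FP g ->
  FP (fun x => if is_node (c x) then f x else g x).
Proof.
move=> [Tc [[wc cc] bTc bc]] [Tf [[wf cf] bTf bf]] [Tg [[wg cg] bTg bg]].
exists (fun x => Tc x + Tf x + Tg x + 3); split.
- exists (wc + wf + wg + 2) => v.
  have [pc cpc] := cc v.+1; have [pf cpf] := cf v; have [pg cpg] := cg v.
  exists (Seq (Assign v.+1 (Var v)) (Seq pc (If (Var v.+1) pf pg))) => s r x sv.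
  set s1 := update s v.+1 x.
  have [s2 [t2 [ex2 le2 v2 fr2]]] := cpc s1 r x (update_same _ _ _).
  have s2v : s2 v = x by rewrite fr2 /s1 ?update_other //; lia.
  have [s3 [t3 [ex3 le3 v3 fr3]]] : exists s3 t3,
      [/\ exec (if is_node (eval s2 (Var v.+1)) then pf else pg) s2 r s3 r t3,
          t3 <= Tf x + Tg x, s3 v = (if is_node (c x) then f x else g x) &
          forall y, (y < v) || (v + wf + wg <= y) -> s3 y = s2 y].
    rewrite /= v2; case: ifP => _.
      have [s3 [t3 [ex3 le3 v3 fr3]]] := cpf s2 r x s2v.
      by exists s3, t3; split=> // [|y yv]; [lia | rewrite fr3 //; lia].
    have [s3 [t3 [ex3 le3 v3 fr3]]] := cpg s2 r x s2v.
    by exists s3, t3; split=> // [|y yv]; [lia | rewrite fr3 //; lia].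
  exists s3, (1 + (t2 + t3.+1)); split=> //.
  + apply: exec_Seq (exec_Assign _ _ _ _) _; rewrite /= sv.
    by apply: exec_Seq ex2 _; exact: exec_If.
  + by move: le2 le3; lia.
  + move=> y yv; rewrite fr3; last by lia.
    by rewrite fr2 /s1 ?update_other //; lia.
- apply: poly_bounded_add (poly_bounded_const _); apply: poly_bounded_add bTg.
  exact: poly_bounded_add.
- apply: poly_bounded_le (poly_bounded_add bf bg) => x.
  by case: ifP; lia.
Qed.

(** * Bounded iteration along a list *)

Fixpoint spine (t : tree) : seq tree :=
  if t is Node x t' then x :: spine t' else [::].

Lemma size_spine t : size (spine t) <= tree_size t.
Proof. by elim: t => //= l _ r IHr; lia. Qed.

Lemma size_mem_spine l l0 y l1 :
  spine l = l0 ++ y :: l1 -> tree_size y <= tree_size l.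
Proof.
elim: l l0 => [|z _ l IHl] [|z0 l0] //= [eqz E]; first by subst; lia.
by have := IHl _ E; lia.
Qed.

(** The function [step] sees only its argument, so the environment [c] travels with every call. *)
Definition fold_tree (step : tree -> tree) (c a l : tree) : tree :=
  foldl (fun a y => step (Node c (Node y a))) a (spine l).

Section Fold.

Variables (step : tree -> tree) (C d : nat).
(** Iterating a polynomial-time step can be exponential: one that doubles its accumulator is an
    example. An increment that does not depend on [a] keeps the whole fold polynomial. *)
Hypothesis growth : forall c y a,
  tree_size (step (Node c (Node y a))) <=
  tree_size a + C * (tree_size (Node c y)) ^ d.

Lemma fold_tree_growth c a l :
  tree_size (fold_tree step c a l) <=
  tree_size a + tree_size l * (C * tree_size (Node c l) ^ d).
Proof.
rewrite /fold_tree; elim: l a => [|y _ l IHl] a; first by rewrite /=; lia.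
apply: leq_trans (IHl _) _.
have le1 := growth c y a.
have le2 : C * tree_size (Node c l) ^ d <= C * tree_size (Node c (Node y l)) ^ d.
  by rewrite leq_mul2l leq_expl ?orbT //=; lia.
have le3 : C * tree_size (Node c y) ^ d <= C * tree_size (Node c (Node y l)) ^ d.
  by rewrite leq_mul2l leq_expl ?orbT //=; lia.
set X := C * _ in le3; rewrite -/X in le2.
have le4 := leq_mul (leqnn (tree_size l)) le2.
have -> : tree_size (Node y l) = tree_size y + (tree_size l + 1) by rewrite /= addn1 addnS.
rewrite mulnDl mulnDl mul1n.
have := leq_trans le1 (leq_add (leqnn _) le3).
by move: le4; rewrite -/X; lia.
Qed.

Lemma FP_fold_step : FP step ->
  FP (fun x => fold_tree step (thd x) (thd (ttl x)) (ttl (ttl x))).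
Proof.
move=> [T [[w cs] bT bs]].
pose B x := tree_size x + tree_size x * (C * (tree_size x).+2 ^ d).
have [D [e leT]] := bT.
pose U x := D * (2 + tree_size x + tree_size x + B x) ^ e.
have bB : poly_bounded B.
  apply: poly_bounded_add poly_bounded_size _.
  apply: poly_bounded_mul poly_bounded_size _.
  apply: poly_bounded_mul (poly_bounded_const _) (poly_bounded_exp _ _).
  by apply: poly_bounded_le (poly_bounded_add poly_bounded_size (poly_bounded_const 2)) => x; lia.
have bU : poly_bounded U.
  apply: poly_bounded_mul (poly_bounded_const _) (poly_bounded_exp _ _).
  apply: poly_bounded_add bB; apply: poly_bounded_add poly_bounded_size.
  exact: poly_bounded_add (poly_bounded_const _) poly_bounded_size.
(* The accumulator after [i] rounds is itself a fold, over the list cut off after [i] entries, so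
   the bound for complete folds applies to it. *)
have sz x : forall i, tree_size (foldl (fun a y => step (Node (thd x) (Node y a)))
    (thd (ttl x)) (take i (spine (ttl (ttl x))))) <= B x.
  move=> i0; pose pre := fix pre i l := match i, l with
    | i.+1, Node y l' => Node y (pre i l') | _, _ => Leaf end.
  have preE i l : take i (spine l) = spine (pre i l).
    by elim: i l => [|i IHi] [|y l] //=; rewrite IHi.
  have size_pre i l : tree_size (pre i l) <= tree_size l.
    by elim: i l => [|i IHi] [|y l] //=; have := IHi l; lia.
  rewrite preE -/(fold_tree _ _ _ _) (leq_trans (fold_tree_growth _ _ _)) //.
  rewrite leq_add ?(leq_trans (size_thd _)) ?size_ttl //.
  have lel := leq_trans (size_pre i0 _) (leq_trans (size_ttl (ttl x)) (size_ttl x)).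
  apply: leq_mul => //; rewrite leq_mul2l; apply/orP; right.
  suff le1 : tree_size (Node (thd x) (pre i0 (ttl (ttl x)))) <= (tree_size x).+2.
    exact: leq_expl.
  rewrite /= ltnS; have := size_pre i0 (ttl (ttl x)); have := size_ttl (ttl x).
  by case: x {lel} => [|x1 x2] /=; lia.
exists (fun x => 5 + tree_size x * (U x + 4)); split.
- exists (w + 5) => v; have [p cp] := cs (v + 4).
  (* Layout: [v + 1] holds the environment, [v + 2] the accumulator, [v + 3] the rest of the list,
     and the step runs at [v + 4]. *)
  pose body := Seq (Assign (v + 4) (Cons (Var (v + 1)) (Cons (Hd (Var (v + 3))) (Var (v + 2)))))
    (Seq p (Seq (Assign (v + 2) (Var (v + 4))) (Assign (v + 3) (Tl (Var (v + 3)))))).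
  exists (Seq (Assign (v + 1) (Hd (Var v))) (Seq (Assign (v + 2) (Hd (Tl (Var v))))
    (Seq (Assign (v + 3) (Tl (Tl (Var v)))) (Seq (While (Var (v + 3)) body)
      (Assign v (Var (v + 2))))))) => s r x sv.
  (* Loop invariant, with [l0] the part of the list already consumed. *)
  have loop l0 s1 : spine (ttl (ttl x)) = l0 ++ spine (s1 (v + 3)) ->
      s1 (v + 1) = thd x ->
      s1 (v + 2) = foldl (fun a y => step (Node (thd x) (Node y a))) (thd (ttl x)) l0 ->
      exists s2 t, [/\ exec (While (Var (v + 3)) body) s1 r s2 r t,
        t <= 1 + size (spine (s1 (v + 3))) * (U x + 4),
        s2 (v + 2) = fold_tree step (thd x) (thd (ttl x)) (ttl (ttl x)) &
        forall y, (y <= v) || (v + w + 5 <= y) -> s2 y = s1 y].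
    move E: (s1 (v + 3)) => l; elim: l l0 s1 E => [|y _ l IHl] l0 s1 E split1 E1 E2.
      exists s1, 1; split=> //; first by apply: exec_While_stop; rewrite /= E.
      by rewrite E2 /fold_tree split1 cats0.
    set a := s1 (v + 2).
    set s2 := update s1 (v + 4) (Node (thd x) (Node y a)).
    have [s3 [t3 [ex3 le3 v3 fr3]]] := cp s2 r _ (update_same _ _ _).
    set s4 := update s3 (v + 2) (s3 (v + 4)).
    set s5 := update s4 (v + 3) l.
    have s3o z : z < v + 4 -> s3 z = s1 z.
      by move=> zv; rewrite fr3 /s2 ?update_other //; lia.
    have [||||s6 [t6 [ex6 le6 v6 fr6]]] := IHl (rcons l0 y) s5.
    + by rewrite /s5 update_same.
    + by rewrite cat_rcons.
    + by rewrite /s5 /s4 !update_other ?s3o ?E1 //; lia.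
    + rewrite {1}/s5 update_other; last by lia.
      by rewrite /s4 update_same v3 /a E2 foldl_rcons.
    exists s6, ((1 + (t3 + (1 + 1))) + t6).+1; split=> //.
    + apply: exec_While_loop ex6; first by rewrite /= E.
      apply: exec_Seq; last apply: exec_Seq ex3 _.
        have -> : s2 = update s1 (v + 4)
            (eval s1 (Cons (Var (v + 1)) (Cons (Hd (Var (v + 3))) (Var (v + 2))))).
          by rewrite /= E E1.
        exact: exec_Assign.
      apply: exec_Seq; first exact: exec_Assign.
      have -> : s5 = update s4 (v + 3) (eval s4 (Tl (Var (v + 3)))).
        by rewrite /= {2}/s4 update_other ?s3o ?E //; lia.
      exact: exec_Assign.
    + suff leU : t3 <= U x by move: le6 => /=; nia.
      apply: leq_trans le3 (leq_trans (leT _) _).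
      rewrite leq_mul2l; apply/orP; right.
      suff le1 : tree_size (Node (thd x) (Node y a)) <= 2 + tree_size x + tree_size x + B x.
        exact: leq_expl.
      have lea : tree_size a <= B x.
        by have := sz x (size l0); rewrite split1 take_size_cat // -E2.
      have ley : tree_size y <= tree_size x.
        by rewrite (leq_trans (size_mem_spine split1)) // (leq_trans (size_ttl _)) ?size_ttl.
      by have := size_thd x; rewrite /=; lia.
    + move=> z zv; rewrite fr6 // /s5 /s4 !update_other ?fr3 /s2 ?update_other //; lia.
  set s1 := update s (v + 1) (thd x).
  set s2 := update s1 (v + 2) (thd (ttl x)).
  set s3 := update s2 (v + 3) (ttl (ttl x)).
  have [|||s4 [t4 [ex4 le4 v4 fr4]]] := loop [::] s3.
  - by rewrite /s3 update_same.
  - rewrite /s3 update_other; last by lia.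
    by rewrite /s2 update_other; [exact: update_same | lia].
  - by rewrite /s3 update_other; [exact: update_same | lia].
  exists (update s4 v (s4 (v + 2))), (1 + (1 + (1 + (t4 + 1)))); split.
  - apply: exec_Seq; first exact: exec_Assign.
    rewrite /= sv -/s1.
    apply: exec_Seq; first exact: exec_Assign.
    have s1v : s1 v = x by rewrite /s1 update_other //; lia.
    rewrite /= s1v -/s2.
    apply: exec_Seq; first exact: exec_Assign.
    have s2v : s2 v = x by rewrite /s2 update_other //; lia.
    rewrite /= s2v -/s3.
    by apply: exec_Seq ex4 _; exact: exec_Assign.
  - have les : size (spine (s3 (v + 3))) <= tree_size x.
      by rewrite /s3 update_same (leq_trans (size_spine _)) // (leq_trans (size_ttl _)) ?size_ttl.
    by move: le4; nia.
  - by rewrite update_same.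
  - by move=> y yv; rewrite update_other ?fr4 /s3 /s2 /s1 ?update_other //; lia.
- apply: poly_bounded_add (poly_bounded_const _) (poly_bounded_mul poly_bounded_size _).
  exact: poly_bounded_add (poly_bounded_const _).
- by apply: poly_bounded_le bB => x; have := sz x (size (spine (ttl (ttl x)))); rewrite take_size.
Qed.

End Fold.

Lemma FP_fold step g c a l : FP step -> poly_bounded g ->
    (forall c y a, tree_size (step (Node c (Node y a))) <=
                   tree_size a + g (Node c y)) ->
  FP c -> FP a -> FP l -> FP (fun x => fold_tree step (c x) (a x) (l x)).
Proof.
move=> fstep [C [d leg]] growth fc fa fl.
have growth' c' y a' : tree_size (step (Node c' (Node y a'))) <=
    tree_size a' + C * tree_size (Node c' y) ^ d.
  by rewrite (leq_trans (growth _ _ _)) // leq_add2l.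
exact: FP_comp (FP_fold_step growth' fstep) (FP_Node fc (FP_Node fa fl)).
Qed.

Lemma FP_iter_ttl k f : FP f -> FP (fun x => iter k ttl (f x)).
Proof. by move=> ff; elim: k => //= k IHk; exact: FP_comp FP_ttl IHk. Qed.

Lemma FP_eq_const c : exists2 g, FP g & forall x, is_node (g x) <-> x = c.
Proof.
elim: c => [|l [gl fl el] r [gr fr er]].
  exists (fun x => if is_node x then Leaf else Node Leaf Leaf).
    exact: FP_if FP_id (FP_const _) (FP_const _).
  by case.
exists (fun x => if is_node x then if is_node (gl (thd x)) then gr (ttl x)
                 else Leaf else Leaf).
  apply: FP_if FP_id (FP_if _ _ (FP_const _)) (FP_const _).
    exact: FP_comp fl FP_thd.
  exact: FP_comp fr FP_ttl.
case=> //= x y; case: ifP => [/el-> | nl].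
  by split=> [/er-> | [->]] //; exact/er.
by split=> // -[/el]; rewrite nl.
Qed.

(** A chain of equality tests. The size bound also covers arguments that are no keys, as the growth
    condition on folds ranges over all trees. *)
Lemma FP_finite (T : finType) (key val : T -> tree) : injective key ->
  exists g, [/\ FP g, forall x, g (key x) = val x &
                exists B, forall t, tree_size (g t) <= B].
Proof.
move=> key_inj; suff [g [fg gE gB]] : exists g, [/\ FP g,
    {in enum T, forall x, g (key x) = val x} & exists B, forall t, tree_size (g t) <= B].
  by exists g; split=> // x; rewrite gE // mem_enum.
elim: (enum T) => [|x s [g [fg gE [B gB]]]].
  by exists (fun=> Leaf); split=> //; [exact: FP_const | exists 1].
have [e fe eE] := FP_eq_const (key x).
exists (fun t => if is_node (e t) then val x else g t); split.
- exact: FP_if fe (FP_const _) fg.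
- move=> y; rewrite inE; case: (eqVneq y x) => [-> _ | nyx /= ys].
    by rewrite (eE _).2.
  by case: ifP => [/eE/key_inj eyx | _]; [rewrite eyx eqxx in nyx | exact: gE].
- exists (tree_size (val x) + B) => t; case: ifP => _; first by lia.
  by have := gB t; lia.
Qed.

(** * Lists and numbers as trees *)

Lemma spine_list_tree T (f : T -> tree) s : spine (list_tree f s) = map f s.
Proof. by elim: s => //= x s ->. Qed.

Lemma eq_list_tree T (f g : T -> tree) s : f =1 g -> list_tree f s = list_tree g s.
Proof. by move=> fg; elim: s => //= x s ->; rewrite fg. Qed.

Lemma list_tree_map T U (f : U -> tree) (h : T -> U) s :
  list_tree f (map h s) = list_tree (f \o h) s.
Proof. by elim: s => //= x s ->. Qed.

Lemma bool_tree_inj : injective bool_tree.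
Proof. by case=> -[]. Qed.

Lemma is_node_bool_tree b : is_node (bool_tree b) = b.
Proof. by case: b. Qed.

Lemma pos_tree_inj : injective pos_tree.
Proof.
elim=> [p IHp | p IHp |] [p'|p'|] //= E; try (by case: E => /IHp->).
  by case: E; case: p {IHp}.
by case: E; case: p'.
Qed.

Lemma nat_tree_inj : injective nat_tree.
Proof.
move=> m n; rewrite /nat_tree => E; apply: (can_inj bin_of_natK).
case: (bin_of_nat m) (bin_of_nat n) E => [|p] [|p'] //=.
- by case: p'.
- by case: p.
- by move/pos_tree_inj->.
Qed.

Lemma nat_tree_pos n : 0 < n ->
  nat_tree n = Node (bool_tree (odd n)) (nat_tree n./2).
Proof.
rewrite -[n]bin_of_natK /nat_tree; case: (bin_of_nat n) => // p _.
rewrite nat_of_binK /=; case: p => [p|p|] //=.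
- rewrite NatTrec.doubleE /= odd_double /= uphalf_double.
  by rewrite -[X in bin_of_nat X]/(nat_of_bin (BinNums.Npos p)) nat_of_binK.
- rewrite NatTrec.doubleE odd_double doubleK.
  by rewrite -[X in bin_of_nat X]/(nat_of_bin (BinNums.Npos p)) nat_of_binK.
Qed.

Lemma ttl_nat_tree n : ttl (nat_tree n) = nat_tree n./2.
Proof. by case: n => // n; rewrite nat_tree_pos. Qed.

Lemma thd_nat_tree n : thd (nat_tree n) = bool_tree (odd n).
Proof. by case: n => // n; rewrite nat_tree_pos. Qed.

Lemma iter_ttl_nat_tree k n : iter k ttl (nat_tree n) = nat_tree (n %/ 2 ^ k).
Proof.
elim: k => [|k IHk]; first by rewrite divn1.
by rewrite /= IHk ttl_nat_tree expnSr divnMA divn2.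
Qed.

(** A fold pushes onto the front of its accumulator, so reversing concatenation is the natural
    primitive; the [rev] and [catrev] in the reduction record the resulting order. *)
Definition catrev_tree (a b : tree) : tree :=
  fold_tree (fun z => Node (thd (ttl z)) (ttl (ttl z))) Leaf b a.

Lemma catrev_tree_list T (f : T -> tree) s t :
  catrev_tree (list_tree f s) (list_tree f t) = list_tree f (catrev s t).
Proof. by rewrite /catrev_tree /fold_tree spine_list_tree; elim: s t => //= x s IHs t; exact: (IHs (x :: t)). Qed.

Lemma size_catrev_tree a b : tree_size (catrev_tree a b) <= tree_size a + tree_size b.
Proof.
rewrite /catrev_tree /fold_tree; elim: a b => [|y _ a IHa] b /=; first by lia.
by apply: leq_trans (IHa _) _; rewrite /=; lia.
Qed.

Lemma FP_thd_of f : FP f -> FP (fun x => thd (f x)).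
Proof. exact: FP_comp FP_thd. Qed.

Lemma FP_ttl_of f : FP f -> FP (fun x => ttl (f x)).
Proof. exact: FP_comp FP_ttl. Qed.

Lemma FP_catrev f g : FP f -> FP g -> FP (fun x => catrev_tree (f x) (g x)).
Proof.
move=> ff fg; apply: (@FP_fold _ (fun z => tree_size z)) (FP_const _) fg ff.
- apply: FP_Node; first exact: FP_thd_of FP_ttl.
  exact: FP_ttl_of FP_ttl.
- exact: poly_bounded_size.
- by move=> c y a /=; lia.
Qed.

Definition flatmap_tree (h : tree -> tree) (c l : tree) : tree :=
  fold_tree (fun z => catrev_tree (h (Node (thd z) (thd (ttl z)))) (ttl (ttl z)))
    c Leaf l.

Lemma FP_flatmap h c l : FP h -> FP c -> FP l ->
  FP (fun x => flatmap_tree h (c x) (l x)).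
Proof.
move=> fh fc fl; have [T [_ _ bh]] := fh.
apply: (@FP_fold _ (fun z => tree_size (h z))) fc (FP_const _) fl => //.
  apply: FP_catrev; last exact: FP_ttl_of FP_ttl.
  by apply: FP_comp fh (FP_Node FP_thd _); exact: FP_thd_of FP_ttl.
by move=> c' y a /=; rewrite addnC size_catrev_tree.
Qed.

Lemma flatmap_tree_list (T : eqType) U (f : T -> tree) (g : U -> tree) h hs c s :
    {in s, forall y, h (Node c (f y)) = list_tree g (hs y)} ->
  flatmap_tree h c (list_tree f s) = list_tree g (rev (flatten (map hs s))).
Proof.
rewrite /flatmap_tree /fold_tree spine_list_tree /= => hE.
suff H a : foldl (fun a y => catrev_tree (h (Node c y)) a) (list_tree g a) (map f s) =
    list_tree g (catrev (flatten (map hs s)) a) by exact: (H [::]).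
elim: s a hE => //= y s IHs a hE; rewrite hE ?mem_head // catrev_tree_list.
by rewrite IHs ?catrev_catl // => z zs; apply: hE; rewrite inE zs orbT.
Qed.

Section Affine.

Variable q : nat.
Hypothesis q_gt0 : 0 < q.

(** Reads the bits of [j], least significant first, with the carry as state. *)
Lemma FP_affine : exists g, FP g /\
  forall j e, e <= q -> g (Node (nat_tree j) (nat_tree e)) = nat_tree (j * q + e).
Proof.
(* The carry stays at most [q], since [(q + q)./2 <= q]; so the transitions form a finite table. *)
pose key (x : bool * 'I_q.+1) := Node (bool_tree x.1) (nat_tree x.2).
pose val (x : bool * 'I_q.+1) :=
  Node (bool_tree (odd (x.1 * q + x.2))) (nat_tree (x.1 * q + x.2)./2).
have key_inj : injective key.
  by move=> [b i] [b' i'] [] /bool_tree_inj /= -> /nat_tree_inj/val_inj->.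
have [tab [ftab tabE [B tabB]]] := FP_finite val key_inj.
pose entry z := tab (Node (thd (ttl z)) (ttl (ttl (ttl z)))).
pose step z := Node (Node (thd (entry z)) (thd (ttl (ttl z)))) (ttl (entry z)).
have fentry : FP entry.
  apply: FP_comp ftab (FP_Node _ _); first exact: FP_thd_of FP_ttl.
  exact: FP_ttl_of (FP_ttl_of FP_ttl).
pose run j e := fold_tree step Leaf (Node Leaf e) j.
pose g z := catrev_tree (thd (run (thd z) (ttl z))) (ttl (run (thd z) (ttl z))).
have frun : FP (fun z => run (thd z) (ttl z)).
  apply: (@FP_fold _ (fun=> B + B + 2)) (FP_const _) (FP_Node (FP_const _) FP_ttl) FP_thd.
  - apply: FP_Node; last exact: FP_ttl_of fentry.
    by apply: FP_Node; [exact: FP_thd_of fentry | exact: FP_thd_of (FP_ttl_of FP_ttl)].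
  - exact: poly_bounded_const.
  - move=> c y a; rewrite /step /=.
    set t := entry _; have tB : tree_size t <= B by exact: tabB.
    by have := size_thd t; have := size_ttl t; have := size_thd a; lia.
exists g; split; first by apply: FP_catrev; [exact: FP_thd_of frun | exact: FP_ttl_of frun].
suff loop j c out : c <= q ->
    let a := fold_tree step Leaf (Node out (nat_tree c)) (nat_tree j) in
    catrev_tree (thd a) (ttl a) = catrev_tree out (nat_tree (j * q + c)).
  by move=> j e eq; rewrite /g /= /run loop.
have stepE (b : bool) i o : i <= q ->
    step (Node Leaf (Node (bool_tree b) (Node o (nat_tree i)))) =
    Node (Node (bool_tree (odd (b * q + i))) o) (nat_tree (b * q + i)./2).
  move=> leiq; rewrite /step /entry /=.
  by have := tabE (b, inord i); rewrite /key /val /= inordK // => ->.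
elim/ltn_ind: j c out => -[|j] IHj c out lecq //=.
rewrite (nat_tree_pos (ltn0Sn j)).
have foldE a y l : fold_tree step Leaf a (Node y l) =
  fold_tree step Leaf (step (Node Leaf (Node y a))) l by [].
set b := odd j.+1.
have hv : (b * q + c)./2 <= q by case: (b) => /=; lia.
rewrite foldE stepE // IHj //; last by rewrite -divn2 ltn_Pdiv.
rewrite [in RHS]nat_tree_pos ?addn_gt0 ?muln_gt0 ?q_gt0 //.
have -> : (j.+1 * q + c) = (b * q + c) + (j.+1./2 * q).*2.
  by rewrite -{1}(odd_double_half j.+1) -/b; lia.
have oddE u v : odd (u + v.*2) = odd u by lia.
have halfE u v : (u + v.*2)./2 = v + u./2 by lia.
by rewrite oddE halfE.
Qed.

End Affine.

(** * Equality of bit strings, membership, removal of duplicates *)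

Definition eq_bits_tree (a b : tree) : tree :=
  let r := fold_tree (fun z =>
    Node (if is_node (ttl (ttl (ttl z))) then
            if is_node (thd (ttl z)) then
              if is_node (thd (ttl (ttl (ttl z)))) then thd (ttl (ttl z)) else Leaf
            else if is_node (thd (ttl (ttl (ttl z)))) then Leaf else thd (ttl (ttl z))
          else Leaf) (ttl (ttl (ttl (ttl z))))) Leaf (Node (Node Leaf Leaf) b) a in
  if is_node (ttl r) then Leaf else thd r.

Lemma eq_bits_treeE s t :
  is_node (eq_bits_tree (list_tree bool_tree s) (list_tree bool_tree t)) = (s == t).
Proof.
rewrite /eq_bits_tree /fold_tree spine_list_tree.
set step := (fun a y => _).
pose final r := is_node (if is_node (ttl r) then Leaf else thd r).
suff H fl : final (foldl step (Node fl (list_tree bool_tree t)) (map bool_tree s)) =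
    (s == t) && is_node fl by rewrite -/(final _) H andbT.
elim: s t fl => [|x s IHs] t fl /=; first by case: t.
case: t => [|y t]; last by rewrite /= IHs eqseq_cons; case: x y => -[] //=; rewrite ?andbF.
by rewrite (IHs [::] Leaf) andbF.
Qed.

Lemma FP_eq_bits f g : FP f -> FP g -> FP (fun x => eq_bits_tree (f x) (g x)).
Proof.
move=> ff fg; pose step z :=
    Node (if is_node (ttl (ttl (ttl z))) then
            if is_node (thd (ttl z)) then
              if is_node (thd (ttl (ttl (ttl z)))) then thd (ttl (ttl z)) else Leaf
            else if is_node (thd (ttl (ttl (ttl z)))) then Leaf else thd (ttl (ttl z))
          else Leaf) (ttl (ttl (ttl (ttl z)))).
pose r x := fold_tree step Leaf (Node (Node Leaf Leaf) (g x)) (f x).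
have f2 : FP (fun z => ttl (ttl z)) := FP_ttl_of FP_ttl.
have f3 : FP (fun z => ttl (ttl (ttl z))) := FP_ttl_of f2.
have fr : FP r.
  apply: (@FP_fold _ (fun=> 3)) (FP_const _) (FP_Node (FP_const _) fg) ff.
  - have fthen := FP_if (FP_thd_of f3) (FP_thd_of f2) (FP_const Leaf).
    have felse := FP_if (FP_thd_of f3) (FP_const Leaf) (FP_thd_of f2).
    have fflag := FP_if f3 (FP_if (FP_thd_of FP_ttl) fthen felse) (FP_const Leaf).
    exact: (FP_Node fflag (FP_ttl_of f3)).
  - exact: poly_bounded_const.
  - move=> c y a; rewrite /step /=; set u := if _ then _ else _.
    have leu : tree_size u <= tree_size (thd a).
      by rewrite /u; do ![case: ifP => _ //]; exact: tree_size_gt0.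
    by case: a @u leu => [|a1 a2] u /=; [|have := size_ttl a2]; lia.
by apply: FP_if (FP_ttl_of fr) (FP_const _) (FP_thd_of fr).
Qed.

Definition mem_tree (x l : tree) : tree :=
  fold_tree (fun z => if is_node (eq_bits_tree (thd z) (thd (ttl z)))
                      then Node Leaf Leaf else ttl (ttl z)) x Leaf l.

Lemma FP_mem f g : FP f -> FP g -> FP (fun x => mem_tree (f x) (g x)).
Proof.
move=> ff fg; apply: (@FP_fold _ (fun=> 3)) ff (FP_const _) fg.
- apply: FP_if (FP_const _) (FP_ttl_of FP_ttl).
  exact: FP_eq_bits FP_thd (FP_thd_of FP_ttl).
- exact: poly_bounded_const.
- by move=> c y a /=; case: ifP => _ /=; lia.
Qed.

Definition undup_tree (l : tree) : tree :=
  fold_tree (fun z => if is_node (mem_tree (thd (ttl z)) (ttl (ttl z)))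
                      then ttl (ttl z) else ttl z) Leaf Leaf l.

Lemma FP_undup f : FP f -> FP (fun x => undup_tree (f x)).
Proof.
move=> ff; apply: (@FP_fold _ (fun z => tree_size z)) (FP_const _) (FP_const _) ff.
- apply: FP_if (FP_ttl_of FP_ttl) FP_ttl.
  exact: FP_mem (FP_thd_of FP_ttl) (FP_ttl_of FP_ttl).
- exact: poly_bounded_size.
- by move=> c y a /=; case: ifP => _ /=; lia.
Qed.

Section Undup.

Variables (T : eqType) (f : T -> seq bool).
Hypothesis f_inj : injective f.

Let g x := list_tree bool_tree (f x).

Lemma mem_treeE x s : is_node (mem_tree (g x) (list_tree g s)) = (x \in s).
Proof.
rewrite /mem_tree /fold_tree spine_list_tree.
set step := (fun a y => _).
suff H a : is_node (foldl step a (map g s)) = (x \in s) || is_node a.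
  by rewrite H orbF.
elim: s a => //= y s IHs a; rewrite IHs /step /= eq_bits_treeE (inj_eq f_inj) inE.
by case: eqVneq; rewrite ?orbT.
Qed.

Definition rev_undup (s : seq T) : seq T :=
  foldl (fun a y => if y \in a then a else y :: a) [::] s.

Lemma mem_rev_undup s : rev_undup s =i s.
Proof.
suff H a : foldl (fun a y => if y \in a then a else y :: a) a s =i a ++ s.
  exact: (H [::]).
elim: s a => [|y s IHs] a x /=; first by rewrite cats0.
rewrite IHs; case: ifP => ya; rewrite !(mem_cat, inE); last by rewrite orbCA orbA.
by case: eqVneq => [->|]; rewrite ?ya.
Qed.

Lemma rev_undup_uniq s : uniq (rev_undup s).
Proof.
rewrite /rev_undup; have: uniq ([::] : seq T) by [].
elim: s [::] => //= y s IHs a ua; case: ifP => ya; apply: IHs => //=.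
by rewrite ya.
Qed.

Lemma undup_treeE s : undup_tree (list_tree g s) = list_tree g (rev_undup s).
Proof.
rewrite /undup_tree /fold_tree spine_list_tree /rev_undup -[Leaf in LHS]/(list_tree g [::]).
pose step (a y : tree) := if is_node (mem_tree y a) then a else Node y a.
suff H a : foldl step (list_tree g a) (map g s) =
    list_tree g (foldl (fun a y => if y \in a then a else y :: a) a s).
  exact: (H [::]).
elim: s a => [|y s IHs] a //=.
by rewrite {2}/step mem_treeE; case: ifP => _; rewrite -IHs.
Qed.

End Undup.

(** * The reduction and its parity *)

Lemma even_card_involution (T : finType) (P : pred T) (f : T -> T) :
    {in P, forall x, f x \in P} -> {in P, forall x, f (f x) = x} ->
  {in P, forall x, f x != x} -> ~~ odd #|P|.
Proof.
(* The ranks choose one element from each orbit of [f]. *)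
move=> fP ffK fN; pose A := [set x in P | enum_rank x < enum_rank (f x)].
pose B := [set x in P | enum_rank (f x) < enum_rank x].
have BE : B = f @: A.
  apply/setP=> x; apply/idP/imsetP => [|[y]]; rewrite !inE.
    by case/andP=> xP lt; exists (f x); rewrite ?inE ?ffK ?fP.
  by case/andP=> yP lt ->; rewrite ffK // fP.
have -> : #|P| = #|A :|: B|.
  apply: eq_card => x; rewrite !inE -andb_orr.
  case xP: (x \in P) => //=; rewrite -neq_ltn; apply/esym.
  by rewrite (inj_eq val_inj) (inj_eq enum_rank_inj) eq_sym fN.
have -> : #|A :|: B| = #|A| + #|B|.
  rewrite cardsU; suff -> : A :&: B = set0 by rewrite cards0 subn0.
  by apply/setP=> x; rewrite !inE; case: (x \in P) => //=; lia.
rewrite BE card_in_imset ?addnn ?odd_double // => x y.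
by rewrite !inE => /andP[xP _] /andP[yP _] E; rewrite -(ffK _ xP) E ffK.
Qed.

(** The [2 ^ p] subsets have only [p.+1] sizes, so one size is taken often. *)
Lemma constant_weight_code (m p : nat) : p.+1 * 2 ^ m <= 2 ^ p ->
  exists enc : {set 'I_m} -> {set 'I_p},
    injective enc /\ forall x y, #|enc x| = #|enc y|.
Proof.
move=> le.
have [h leh] : exists h : 'I_p.+1, 2 ^ m <= 'C(p, h).
  apply/existsP; apply: contraLR le => /existsPn small; rewrite -ltnNge.
  rewrite (_ : 2 ^ p = (1 + 1) ^ p) // expnDn.
  rewrite -[X in _ < X * _]card_ord -sum_nat_const.
  apply: (@leq_trans (\sum_(i < p.+1) ('C(p, i)).+1)); last first.
    by apply: leq_sum => i _; have := small i; rewrite -ltnNge.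
  rewrite (eq_bigr (fun i : 'I_p.+1 => 'C(p, i))) => [|i _]; last by rewrite !exp1n !muln1.
  by under [X in _ < X]eq_bigr do rewrite -addn1; rewrite big_split /= sum1_card card_ord; lia.
pose X := [set A : {set 'I_p} | #|A| == h].
have cX : #|{: {set 'I_m}}| <= #|X|.
  by rewrite card_draws card_ord -cardsT -powersetT card_powerset cardsT card_ord.
pose enc x := enum_val (widen_ord cX (enum_rank x)).
exists enc; split=> [x y /enum_val_inj/(congr1 val)/= | x y].
  by move/val_inj/enum_rank_inj.
have := enum_valP (widen_ord cX (enum_rank x)).
have := enum_valP (widen_ord cX (enum_rank y)).
by rewrite !inE => /eqP-> /eqP->.
Qed.

Lemma all_flatten T (P : pred T) ss : all P (flatten ss) = all (all P) ss.
Proof. by elim: ss => //= s ss IHss; rewrite all_cat IHss. Qed.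

Section Reduction.

Variable b : nat.
Local Notation beta := (2 ^ b).
Local Notation p := (2 ^ b + b + 2).
Local Notation q := p.+1.

Variable enc : {set 'I_beta} -> {set 'I_p}.
Hypothesis enc_inj : injective enc.
Hypothesis enc_card : forall x y, #|enc x| = #|enc y|.

Lemma enc_subset x y : (enc x \subset enc y) = (x == y).
Proof.
apply/idP/eqP => [sxy|->//]; apply: enc_inj; apply/eqP.
by rewrite eqEcard sxy (enc_card y x) leqnn.
Qed.

(** * Hitting constraints for a block *)

Definition elements (A : {set 'I_p}) : seq nat := map val (enum A).

Definition strict (B : {set 'I_p}) : bool := [exists x, enc x \proper B].

Definition meets_all (F : pred {set 'I_p}) : seq {set 'I_p} :=
  enum [pred S : {set 'I_p} | [forall B, F B ==> (B :&: S != set0)]].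

(** Duality of monotone conditions: if [K] includes no member of [F], then [~: K] meets every member
    and is thus a listed set that [K] misses. *)
Lemma all_meets_all F K :
  all (fun S => K :&: S != set0) (meets_all F) = [exists B, F B && (B \subset K)].
Proof.
apply/allP/existsP => [hit | [B /andP[FB sBK]] S].
  apply/existsP; apply: contraT => /existsPn noB.
  have: ~: K \in meets_all F.
    rewrite mem_enum; apply/forallP => B; apply/implyP => FB.
    by have := noB B; rewrite FB /= setI_eq0 -subsets_disjoint.
  by move/hit; rewrite setICr eqxx.
rewrite mem_enum => /forallP/(_ B); rewrite FB /= => /set0Pn[e].
by rewrite inE => /andP[eB eS]; apply/set0Pn; exists e; rewrite inE (subsetP sBK).
Qed.

(** Without [p] these sets force the block to contain a codeword; with [p] they
    hold iff [p] is chosen or the block contains a codeword properly, so that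
    modulo 2 the choice of [p] removes the blocks that are not codewords. *)
Definition block_sets : seq (seq nat) :=
  map elements (meets_all [pred B in codom enc]) ++
  [seq p :: elements A | A <- meets_all strict].

(** To meet the complement of [enc x] is not to lie inside [enc x]; for a core that is a codeword
    this excludes the word [x] and nothing else. *)
Definition code_complements (P : pred {set 'I_beta}) : seq (seq nat) :=
  [seq elements (~: enc x) | x <- enum P].

Definition literal_sets (l : bool * 'I_beta) : seq (seq nat) :=
  code_complements [pred x : {set 'I_beta} | (l.2 \in x) != l.1].

(** The positions [r], [r + 1], ... of the last block carry no variable; these
    sets fix their bits to 0. *)
Definition padding_sets (r : nat) : seq (seq nat) :=
  block_sets ++ code_complements [pred x : {set 'I_beta} | [exists i in x, r <= i]].

(** Block [j] owns the numbers from [j * q] to [j * q + p], the last of them being its extra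
    element. *)
Definition shift_sets (j : nat) (t : seq (seq nat)) : seq (seq nat) :=
  rev [seq rev [seq j * q + e | e <- s] | s <- t].

Definition core (H : pred nat) (j : nat) : {set 'I_p} := [set e : 'I_p | H (j * q + e)].

Lemma all_shift H j t :
  all (has H) (shift_sets j t) = all (has (fun e => H (j * q + e))) t.
Proof.
rewrite /shift_sets all_rev all_map; apply: eq_all => s /=.
by rewrite has_rev has_map.
Qed.

Lemma has_elements H j A :
  has (fun e => H (j * q + e)) (elements A) = (core H j :&: A != set0).
Proof.
rewrite /elements has_map; apply/hasP/set0Pn => [[e eA He]|[e]].
  by rewrite mem_enum in eA; exists e; rewrite !inE eA andbT.
by rewrite !inE => /andP[He eA]; exists e; rewrite ?mem_enum.
Qed.

Lemma all_block_sets H j : all (has H) (shift_sets j block_sets) =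
  [exists x, enc x \subset core H j] && (H (j * q + p) || strict (core H j)).
Proof.
rewrite all_shift all_cat !all_map; congr (_ && _).
  rewrite (eq_all (has_elements H j)) all_meets_all.
  apply/existsP/existsP => [[B /andP[/codomP[x ->]]]|[x sx]]; first by exists x.
  by exists (enc x); rewrite /= codom_f.
case HE: (H _) => /=; first by apply/allP => S _; rewrite /= HE.
rewrite (eq_all (a2 := fun S => core H j :&: S != set0)); last first.
  by move=> S; rewrite /= HE has_elements.
rewrite all_meets_all; apply/existsP/existsP => [[B /andP[/existsP[x pxB]]]|[x px]].
  by move/(proper_sub_trans pxB); exists x.
by exists (core H j); rewrite subxx andbT; apply/existsP; exists x.
Qed.

Lemma all_code_complements H j P : all (has H) (shift_sets j (code_complements P)) =
  [forall x, P x ==> ~~ (core H j \subset enc x)].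
Proof.
rewrite all_shift all_map; apply/allP/forallP => [hit x | hit x].
  apply/implyP => Px; have := hit x; rewrite mem_enum => /(_ Px).
  by rewrite /= has_elements setI_eq0 -subsets_disjoint.
rewrite mem_enum => Px; have := hit x; rewrite [P x]Px /=.
by rewrite has_elements setI_eq0 -subsets_disjoint.
Qed.

Lemma all_literal_sets H j l y : core H j = enc y ->
  all (has H) (shift_sets j (literal_sets l)) = ((l.2 \in y) == l.1).
Proof.
move=> Hy; rewrite all_code_complements; apply/forallP/eqP => [/(_ y) | E x].
  by rewrite Hy subxx implybF negbK => /eqP.
by apply/implyP; apply: contraL; rewrite Hy enc_subset => /eqP<-; rewrite /= E eqxx.
Qed.

Lemma all_padding_sets H j r : all (has H) (shift_sets j (padding_sets r)) =
  all (has H) (shift_sets j block_sets) &&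
  [forall x : {set 'I_beta}, [exists i in x, r <= i] ==> ~~ (core H j \subset enc x)].
Proof.
rewrite all_shift /padding_sets all_cat -!all_shift.
by rewrite all_code_complements.
Qed.

Definition bounded_sets : pred (seq (seq nat)) := all (all (fun e => e < q)).

Lemma elements_bounded A : all (fun e => e < q) (elements A).
Proof. by apply/allP => _ /mapP[e _ ->]; exact: ltnW (ltn_ord e). Qed.

Lemma block_sets_bounded : bounded_sets block_sets.
Proof.
rewrite /bounded_sets all_cat !all_map; apply/andP; split; apply/allP => S _ /=.
  exact: elements_bounded.
by rewrite ltnSn elements_bounded.
Qed.

Lemma code_complements_bounded P : bounded_sets (code_complements P).
Proof. by rewrite /bounded_sets all_map; apply/allP => S _; exact: elements_bounded. Qed.

Lemma literal_sets_bounded l : bounded_sets (literal_sets l).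
Proof. exact: code_complements_bounded. Qed.

Lemma padding_sets_bounded r : bounded_sets (padding_sets r).
Proof.
by rewrite /bounded_sets all_cat; apply/andP; split;
  [exact: block_sets_bounded | exact: code_complements_bounded].
Qed.

Lemma shift_block j t : bounded_sets t ->
  all (all (fun x => x %/ q == j)) (shift_sets j t).
Proof.
move=> /allP bt; rewrite /shift_sets all_rev all_map; apply/allP => s /bt /allP bs /=.
rewrite all_rev all_map; apply/allP => e /bs /= lt.
by rewrite divnMDl // divn_small ?addn0.
Qed.

Lemma eq_all_shift H1 H2 j t : bounded_sets t ->
    (forall x, x %/ q == j -> H1 x = H2 x) ->
  all (has H1) (shift_sets j t) = all (has H2) (shift_sets j t).
Proof.
move=> /(shift_block j) /allP bt eqH; apply: eq_in_all => s /bt /allP bs.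
by apply: eq_in_has => x /bs /eqH.
Qed.

(** Meeting [x] or meeting [y] is meeting their union, so distributivity turns the disjunction of
    two families into a single family. *)
Definition union_products (X Y : seq (seq nat)) : seq (seq nat) :=
  rev (flatten [seq rev [seq catrev x y | y <- Y] | x <- X]).

(** The literal [(j, (v, i))] says that the bit [i] of block [j] is [v]. *)
Fixpoint clause_sets (D : seq (nat * (bool * 'I_beta))) : seq (seq nat) :=
  if D is l :: D' then union_products (shift_sets l.1 (literal_sets l.2)) (clause_sets D')
  else [:: [::]].

Lemma all_clause_sets H D : all (has H) (clause_sets D) =
  has (fun l => all (has H) (shift_sets l.1 (literal_sets l.2))) D.
Proof.
elim: D => //= l D <-; rewrite /union_products all_rev all_flatten all_map.
set X := shift_sets _ _; set Y := clause_sets _.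
have -> : all (preim (fun x => rev [seq catrev x y | y <- Y]) (all (has H))) X =
    all (fun x => has H x || all (has H) Y) X.
  apply: eq_all => x /=; rewrite all_rev all_map.
  elim: Y => [|y Y IHY] /=; first by rewrite orbT.
  by rewrite IHY catrevE has_cat has_rev orb_andr.
by elim: (X) => //= x X' ->; case: (has H x); case: (all _ Y); rewrite ?orbT ?orbF ?andbT.
Qed.

Lemma clause_sets_block D s x : s \in clause_sets D -> x \in s ->
  has (fun l => x %/ q == l.1) D.
Proof.
elim: D s => [|l D IHD] s /=; first by rewrite inE => /eqP->.
rewrite mem_rev => /flattenP[ss /mapP[x1 x1l ->]].
rewrite mem_rev => /mapP[x2 /IHD x2D ->].
rewrite catrevE mem_cat mem_rev => /orP[|/x2D->]; last exact: orbT.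
by move/allP: (shift_block l.1 (literal_sets_bounded l.2)) => /(_ _ x1l)/allP bx /bx->.
Qed.

Lemma beta_gt0 : 0 < beta.
Proof. by rewrite expn_gt0. Qed.

Definition bit_index (i : nat) : 'I_beta := Ordinal (ltn_pmod i beta_gt0).

Definition block_literal n (l : 'I_n * bool) : nat * (bool * 'I_beta) :=
  (l.1 %/ beta, (l.2, bit_index l.1)).

Definition reduced_clause n (s : seq ('I_n * bool)) : seq (seq nat) :=
  catrev (rev (flatten [seq shift_sets (l.1 %/ beta) block_sets | l : 'I_n * bool <- s]))
    (clause_sets [seq block_literal l | l <- rev_undup s]).

(** Only the last block and the blocks with an occurring variable receive sets:
    any other block makes both counts even. *)
Definition reduced_family n (L : seq (seq ('I_n * bool))) : seq (seq nat) :=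
  catrev (shift_sets (n %/ beta) (padding_sets (n %% beta)))
    (rev (flatten [seq reduced_clause s | s <- L])).

(** One block follows the [n %/ beta] full ones even if [beta] divides [n]; the padding then fixes
    its word to the empty set. This keeps the size affine in [n %/ beta]. *)
Definition reduced_size (n : nat) : nat := (n %/ beta).+1 * q.

Section Family.

Variables (n : nat) (L : seq (seq ('I_n * bool))).

Definition occurs (j : nat) : bool :=
  (j == n %/ beta) || has (has (fun l : 'I_n * bool => l.1 %/ beta == j)) L.

Definition valid (H : pred nat) : bool := all (has H) (reduced_family L).

Lemma validE H : valid H = all (has H) (shift_sets (n %/ beta) (padding_sets (n %% beta))) &&
  all (fun s => all (fun l : 'I_n * bool => all (has H) (shift_sets (l.1 %/ beta) block_sets)) s &&
    has (fun l : 'I_n * bool => all (has H) (shift_sets (l.1 %/ beta) (literal_sets (block_literal l).2))) s) L.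
Proof.
rewrite /valid /reduced_family catrevE all_cat all_rev; congr (_ && _).
rewrite all_rev all_flatten all_map; apply: eq_all => s /=.
rewrite /reduced_clause catrevE revK all_cat; congr (_ && _).
  by rewrite all_flatten all_map.
by rewrite all_clause_sets has_map (eq_has_r (mem_rev_undup s)).
Qed.

Lemma eq_valid H1 H2 :
  (forall x, occurs (x %/ q) -> H1 x = H2 x) -> valid H1 = valid H2.
Proof.
move=> eqH; rewrite !validE; congr (_ && _).
  apply: (eq_all_shift (padding_sets_bounded _)) => x /eqP E.
  by apply: eqH; rewrite /occurs E eqxx.
apply: eq_in_all => s sL.
have eqHs l x : l \in s -> x %/ q == l.1 %/ beta -> H1 x = H2 x.
  move=> ls /eqP E; apply: eqH; rewrite /occurs E; apply/orP; right.
  by apply/hasP; exists s => //; apply/hasP; exists l.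
congr (_ && _).
  apply: eq_in_all => l /eqHs eqHl.
  exact: (eq_all_shift block_sets_bounded).
apply: eq_in_has => l /eqHs eqHl.
exact: (eq_all_shift (literal_sets_bounded _)).
Qed.

(** A strict core already meets the sets that were given the extra element, so this element is free
    there. The freedom is what lets toggling cancel the strict blocks. *)
Lemma valid_strict H1 H2 :
    (forall x, (x %% q != p) || ~~ strict (core H1 (x %/ q)) -> H1 x = H2 x) ->
  valid H1 = valid H2.
Proof.
move=> eqH; have eqc j : core H1 j = core H2 j.
  apply/setP=> e; rewrite !inE; apply: eqH.
  by rewrite modnMDl modn_small ?ltnS 1?ltnW // neq_ltn ltn_ord.
have eqG j : all (has H1) (shift_sets j block_sets) = all (has H2) (shift_sets j block_sets).
  rewrite !all_block_sets -eqc; case: (boolP (strict _)) => st; first by rewrite !orbT.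
  by rewrite eqH // divnMDl // divn_small // addn0 st orbT.
rewrite !validE !all_padding_sets eqG eqc; congr (_ && _).
apply: eq_all => s; congr (_ && _); first by apply: eq_all => l; rewrite eqG.
by apply: eq_has => l /=; rewrite !all_code_complements eqc.
Qed.

Lemma valid_blocks H j :
  valid H -> occurs j -> all (has H) (shift_sets j block_sets).
Proof.
rewrite validE all_padding_sets => /andP[/andP[last _] /allP cl].
case/orP=> [/eqP->//|/hasP[s /cl/andP[/allP bs _] /hasP[l /bs bl /eqP<-]]].
exact: bl.
Qed.

Lemma valid_codewords H (y : nat -> {set 'I_beta}) :
    (forall j, j <= n %/ beta -> core H j = enc (y j)) ->
    (forall j, j <= n %/ beta -> H (j * q + p)) ->
  valid H = [forall i in y (n %/ beta), i < n %% beta] &&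
    all (has (fun l : 'I_n * bool => (bit_index l.1 \in y (l.1 %/ beta)) == l.2)) L.
Proof.
move=> coreH extH.
have bG j : j <= n %/ beta -> all (has H) (shift_sets j block_sets).
  move=> lej; rewrite all_block_sets extH // andbT.
  by apply/existsP; exists (y j); rewrite coreH.
rewrite validE all_padding_sets bG //=; congr (_ && _).
  rewrite coreH //; apply/forallP/forallP => [hit i | hit x]; apply/implyP.
    move=> iy; rewrite ltnNge; apply: contraL (hit (y (n %/ beta))) => lei.
    by rewrite subxx implybF negbK; apply/existsP; exists i; rewrite iy.
  case/existsP=> i /andP[ix lei]; rewrite enc_subset //.
  by apply: contraTN (hit i) => /eqP->; rewrite ix /= ltnNge lei.
have le_blk (l : 'I_n * bool) : l.1 %/ beta <= n %/ beta.
  by apply: leq_div2r; apply: ltnW.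
apply: eq_all => s; rewrite (@eq_all _ _ predT) ?all_predT; last first.
  by move=> l; apply: bG.
by apply: eq_has => l /=; rewrite (all_literal_sets _ (coreH _ (le_blk l))).
Qed.

End Family.

(** * Parity by involutions without fixed points *)

Definition pred_of_set n (H : {set 'I_n}) : pred nat :=
  fun x => if insub x is Some i then i \in H else false.

Definition toggle n (x : 'I_n) (H : {set 'I_n}) : {set 'I_n} :=
  [set y | (y \in H) (+) (y == x)].

Lemma toggleK n (x : 'I_n) : involutive (toggle x).
Proof. by move=> H; apply/setP=> y; rewrite !inE -addbA addbb addbF. Qed.

Lemma toggle_neq n (x : 'I_n) H : toggle x H != H.
Proof.
apply/eqP=> /setP/(_ x); rewrite !inE eqxx addbT.
by case: (x \in H).
Qed.

Lemma pred_of_setE n (H : {set 'I_n}) (i : 'I_n) : pred_of_set H i = (i \in H).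
Proof. by rewrite /pred_of_set valK. Qed.

Lemma pred_of_set_toggle n (x : 'I_n) H (y : nat) : y != x ->
  pred_of_set (toggle x H) y = pred_of_set H y.
Proof.
rewrite /pred_of_set; case: insubP => // i _ <- nix.
by rewrite !inE (negPf (_ : i != x)) ?addbF.
Qed.

Lemma reduced_family_parity n (L : seq (seq ('I_n * bool))) :
  odd #|[pred H : {set 'I_(reduced_size n)} | valid L (pred_of_set H)]| =
  odd #|[pred a : {ffun 'I_n -> bool} | all (has (fun l : 'I_n * bool => a l.1 == l.2)) L]|.
Proof.
set m := n %/ beta.
have size_gt j e : j <= m -> e < q -> j * q + e < reduced_size n.
  by rewrite /reduced_size -/m; nia.
(* If the block [j] does not occur, toggle its first element and its first
   variable. *)
have [/forallP occ | /forallPn[j nocc]] := boolP [forall j : 'I_m.+1, occurs L j]; last first.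
  have jm : j < m.
    by rewrite ltn_neqAle -ltnS ltn_ord andbT; apply: contra nocc => jm; rewrite /occurs jm.
  have q_gt0 : 0 < q by [].
  pose x := Ordinal (size_gt j 0 (ltnW jm) q_gt0).
  have jn : j * beta < n.
    by apply: leq_trans (leq_divM n beta); rewrite ltn_mul2r beta_gt0.
  pose i := Ordinal jn.
  rewrite (negPf (@even_card_involution _ _ (toggle x) _ _ _)); first last.
  - by move=> H _; exact: toggle_neq.
  - by move=> H _; exact: toggleK.
  - move=> H; rewrite !inE => vH; rewrite (eq_valid (H2 := pred_of_set H)) // => y occy.
    apply: pred_of_set_toggle; apply: contra nocc => /eqP E.
    by move: occy; rewrite E /= addn0 mulnK.
  pose f (a : {ffun 'I_n -> bool}) := [ffun k => a k (+) (k == i)].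
  rewrite (negPf (@even_card_involution _ _ f _ _ _)) //.
  - move=> a; rewrite !inE => /allP sat; apply/allP => s sL.
    have /hasP[l ls al] := sat s sL; apply/hasP; exists l => //.
    rewrite ffunE; case: (eqVneq l.1 i) => [E|_]; last by rewrite addbF.
    case/negP: nocc; apply/orP; right; apply/hasP; exists s => //.
    by apply/hasP; exists l => //; rewrite E /= mulnK ?beta_gt0.
  - by move=> a _; apply/ffunP=> k; rewrite !ffunE -addbA addbb addbF.
  - by move=> a _; apply/eqP=> /ffunP/(_ i); rewrite ffunE eqxx; case: (a i).
have {}occ j : j <= m -> occurs L j.
  by rewrite -ltnS => ltj; exact: (occ (Ordinal ltj)).
(* Toggling the last element of the first block with a strict core cancels all
   hitting sets that have such a block. *)
pose strict_at (H : {set 'I_(reduced_size n)}) j := strict (core (pred_of_set H) j).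
pose V := [pred H : {set 'I_(reduced_size n)} | valid L (pred_of_set H)].
pose has_strict H := has (strict_at H) (iota 0 m.+1).
rewrite -/V -(cardID [pred H | has_strict H] V) oddD.
pose first H := find (strict_at H) (iota 0 m.+1).
(* [find] returns [m.+1] if no block is strict; the minimum keeps [ext] inside the ground set for
   every [H]. *)
have ext_lt H : minn (first H) m * q + p < reduced_size n.
  by apply: size_gt; rewrite ?geq_minr.
pose ext H := Ordinal (ext_lt H).
(* Extra elements lie outside every core, so toggling one leaves the strict blocks, and with them
   [first], unchanged; hence the second toggle undoes the first. *)
have core_toggle (H H' : {set 'I_(reduced_size n)}) j : core (pred_of_set (toggle (ext H') H)) j = core (pred_of_set H) j.
  apply/setP=> e; rewrite !inE; apply: pred_of_set_toggle; apply/eqP=> /(congr1 (modn^~ q)).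
  rewrite /= !modnMDl !modn_small //; last by rewrite ltnS ltnW.
  by have := ltn_ord e; lia.
have first_toggle H H' : first (toggle (ext H') H) = first H.
  by apply: eq_find => j; rewrite /strict_at core_toggle.
have strict_toggle H H' : has_strict (toggle (ext H') H) = has_strict H.
  by apply: eq_has => j; rewrite /strict_at core_toggle.
have ext_toggle H H' : ext (toggle (ext H') H) = ext H.
  by apply: val_inj; rewrite /= first_toggle.
pose f H := toggle (ext H) H.
rewrite (negPf (@even_card_involution _ _ f _ _ _)) /=; first last.
- by move=> H _; exact: toggle_neq.
- by move=> H _; rewrite /f ext_toggle toggleK.
- move=> H; rewrite !inE /f strict_toggle => /andP[vH st]; rewrite st andbT.
  rewrite -(@valid_strict n L (pred_of_set H)) // => x nx; apply/esym.
  apply: pred_of_set_toggle; apply: contraTN nx => /eqP-> /=.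
  rewrite modnMDl modn_small // eqxx divnMDl // divn_small // addn0 /= negbK.
  have ltf : first H < m.+1.
    by rewrite -[X in _ < X](size_iota 0) -has_find.
  rewrite (minn_idPl _) //; have := nth_find 0 st.
  by rewrite nth_iota.
(* In what remains, every block is a codeword together with its extra element; [Hof] matches these
   sets with the satisfying assignments. *)
pose word (a : {ffun 'I_n -> bool}) (j : nat) := [set i : 'I_beta | [exists k : 'I_n, (k == j * beta + i :> nat) && a k]].
pose Hof (a : {ffun 'I_n -> bool}) : {set 'I_(reduced_size n)} :=
  [set x : 'I__ | (x %% q == p) || (x %% q \in elements (enc (word a (x %/ q))))].
have pHof a j e : j <= m -> e < q -> pred_of_set (Hof a) (j * q + e) =
    (e == p) || (e \in elements (enc (word a j))).
  move=> lej lte; rewrite (pred_of_setE _ (Ordinal (size_gt j e lej lte))) inE /=.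
  by rewrite modnMDl modn_small // divnMDl // divn_small // addn0.
have coreHof a j : j <= m -> core (pred_of_set (Hof a)) j = enc (word a j).
  move=> lej; apply/setP=> e; rewrite inE pHof //; last by rewrite ltnS ltnW.
  by rewrite ltn_eqF //= mem_map ?mem_enum //; exact: val_inj.
have word_lit a (k : 'I_n) : (bit_index k \in word a (k %/ beta)) = a k.
  rewrite inE; apply/existsP/idP => [[k' /andP[/eqP E ak']]|ak].
    by rewrite (_ : k = k') //; apply: val_inj; rewrite /= E /= -divn_eq.
  by exists k; rewrite ak andbT /= -divn_eq.
have validHof a : valid L (pred_of_set (Hof a)) = all (has (fun l : 'I_n * bool => a l.1 == l.2)) L.
  rewrite (@valid_codewords _ L _ (word a)); first last.
  - by move=> j lej; rewrite pHof // eqxx.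
  - exact: coreHof.
  rewrite (_ : [forall _ in _, _] = true) /=.
    by apply: eq_all => s; apply: eq_has => l; rewrite word_lit.
  apply/forallP=> i; apply/implyP; rewrite inE => /existsP[k /andP[/eqP E _]].
  by have := ltn_ord k; rewrite E [X in _ < X](divn_eq n beta) ltn_add2l.
have Hof_inj : injective Hof.
  move=> a a' E; apply/ffunP=> k; rewrite -!word_lit.
  have lek : k %/ beta <= m by apply: leq_div2r; apply: ltnW.
  suff -> : word a (k %/ beta) = word a' (k %/ beta) by [].
  by apply: enc_inj; rewrite -!coreHof // E.
rewrite -[in RHS](card_imset _ Hof_inj); congr odd; apply: eq_card => H.
rewrite !inE; apply/andP/imsetP => [[nst vH] | [a sat ->]]; last first.
  rewrite validHof; split=> //; apply/hasPn => j; rewrite mem_iota add0n ltnS => /andP[_ lej].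
  rewrite /strict_at coreHof //; apply/existsPn => x; rewrite properE !enc_subset //.
  by rewrite [word a j == x]eq_sym andbN.
have nstrict j : j <= m -> ~~ strict_at H j.
  by move=> lej; apply: (hasPn nst); rewrite mem_iota.
(* The default is never taken for [j <= m]: there the core contains a codeword, and not properly. *)
pose y j : {set 'I_beta} := odflt set0 [pick x | enc x == core (pred_of_set H) j].
have coreH j : j <= m -> core (pred_of_set H) j = enc (y j) /\ pred_of_set H (j * q + p).
  move=> lej; have := valid_blocks vH (occ _ lej); rewrite all_block_sets.
  have nst_j := nstrict j lej.
  rewrite -/(strict_at H j) (negPf nst_j) orbF => /andP[/existsP[x sx] ->]; split=> //.
  rewrite /y; case: pickP => [z /eqP-> //|/(_ x)/negbT nx].
  by case/existsP: nst_j; exists x; rewrite properEneq nx.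
pose a := [ffun k : 'I_n => bit_index k \in y (k %/ beta)].
have := vH; rewrite (@valid_codewords _ L _ y); [|by move=> j /coreH[]..].
move=> /andP[/forallP pad sat].
have ya j : j <= m -> word a j = y j.
  move=> lej; apply/setP=> i; rewrite inE; apply/existsP/idP.
    case=> k /andP[/eqP E]; rewrite ffunE E divnMDl ?beta_gt0 // divn_small // addn0.
    by rewrite (_ : bit_index _ = i) //; apply: val_inj; rewrite /= modnMDl modn_small.
  (* Every bit that is set belongs to a variable: in the last block by the padding, in the others
     because they are full. *)
  move=> iy; have ltn : j * beta + i < n.
    rewrite (divn_eq n beta) -/m; case: (eqVneq j m) => [jm|njm].
      by rewrite jm ltn_add2l; have := pad i; rewrite -/m -jm iy.
    have ltj : j < m by rewrite ltn_neqAle njm.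
    by have := ltn_ord i; nia.
  exists (Ordinal ltn); rewrite eqxx /= ffunE /= divnMDl ?beta_gt0 // divn_small // addn0.
  by rewrite (_ : bit_index _ = i) //; apply: val_inj; rewrite /= modnMDl modn_small.
have HE : H = Hof a.
  apply/setP=> x; rewrite inE -pred_of_setE.
  have ltx : x %% q < q by rewrite ltn_mod.
  have lex : x %/ q <= m by rewrite -ltnS ltn_divLR.
  have [cx ex] := coreH _ lex; rewrite {1}(divn_eq x q).
  case: (eqVneq (x %% q) p) => [->|nxp]; first by rewrite ex.
  have ltp : x %% q < p by rewrite ltn_neqAle nxp -ltnS.
  rewrite ya // -cx /= -[x %% q]/(val (Ordinal ltp)) mem_map ?mem_enum ?inE //.
by exists a => //; rewrite inE -validHof -HE.
Qed.

End Reduction.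

(** * Size of the reduced family *)

Lemma leq_card_bigcup (I T : finType) (A : {pred I}) (F : I -> {set T}) :
  #|\bigcup_(i in A) F i| <= \sum_(i in A) #|F i|.
Proof.
elim/big_rec2: _ => [|i m B _ le]; first by rewrite cards0.
by rewrite (leq_trans (leq_card_setU _ _)) // leq_add2l.
Qed.

Section Bounds.

Variable b : nat.
Local Notation beta := (2 ^ b).
Local Notation p := (2 ^ b + b + 2).
Local Notation q := p.+1.

Variable enc : {set 'I_beta} -> {set 'I_p}.
Variables (n : nat) (L : seq (seq ('I_n * bool))).

Lemma reduced_family_blocks s' : s' \in reduced_family enc L ->
  all (fun x => x %/ q == n %/ beta) s' \/
  exists2 s, s \in L & all (fun x => has (fun l : 'I_n * bool => x %/ q == l.1 %/ beta) s) s'.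
Proof.
rewrite /reduced_family catrevE mem_cat mem_rev => /orP[s'pad|].
  by left; apply: (allP (shift_block _ (padding_sets_bounded _ _))) s'pad.
rewrite mem_rev => /flattenP[ss /mapP[s sL ->]].
rewrite /reduced_clause catrevE revK mem_cat => /orP[/flattenP[t /mapP[l ls ->]] s't|s'D].
  right; exists s => //; have /allP bs := allP (shift_block _ (block_sets_bounded _)) _ s't.
  by apply/allP => x /bs bx; apply/hasP; exists l.
right; exists s => //; apply/allP => x xs'; have := clause_sets_block s'D xs'.
by rewrite has_map (eq_has_r (mem_rev_undup s)).
Qed.

Lemma reduced_family_lt : all (all (fun x => x < reduced_size b n)) (reduced_family enc L).
Proof.
apply/allP => s' s'L; apply/allP => x xs'; rewrite -ltn_divLR //.
have [/allP/(_ _ xs')/eqP-> // | [s _ /allP/(_ _ xs')/hasP[l _ /eqP->]]] :=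
  reduced_family_blocks s'L.
by rewrite ltnS leq_div2r // ltnW.
Qed.

Definition hitting_family : {set {set 'I_(reduced_size b n)}} :=
  [set:: [seq [set:: pmap insub s] | s <- reduced_family enc L]].

Lemma hits_hitting_family H : hits H hitting_family = valid enc L (pred_of_set H).
Proof.
have meetE (s : seq nat) : (H :&: [set:: pmap insub s] != set0) = has (pred_of_set H) s.
  apply/set0Pn/hasP => [[x]|[x xs]].
    rewrite !inE mem_pmap => /andP[xH /mapP[y ys E]].
    exists y => //; rewrite /pred_of_set -E //.
  rewrite /pred_of_set; case: insubP => // i _ E iH; exists i.
  by rewrite !inE iH mem_pmap; apply/mapP; exists x; rewrite // -E valK.
apply/'forall_implyP/allP => [hit s sL | hit S].
  by rewrite -meetE; apply: hit; rewrite inE map_f.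
by rewrite inE => /mapP[s sL ->]; rewrite meetE; apply: hit.
Qed.

Lemma encodes_hitting_family :
  encodes_family (fun i : 'I_(reduced_size b n) => nat_tree i) (reduced_size b n)
    hitting_family (Node (nat_tree (reduced_size b n))
      (list_tree (list_tree nat_tree) (reduced_family enc L))).
Proof.
exists [seq pmap insub s | s <- reduced_family enc L]; split.
  by rewrite /hitting_family -map_comp.
congr Node; rewrite list_tree_map.
elim: (reduced_family enc L) reduced_family_lt => //= s M IHM /andP[lts ltM].
rewrite -IHM //; congr Node; elim: s lts => //= x s IHs /andP[ltx lts].
by rewrite insubT /= -IHs.
Qed.

Let F : cnf n := [set:: [seq [set:: s] | s <- L]].

Let blocks (J : pred nat) : {set 'I_(reduced_size b n)} := [set x : 'I__ | J (x %/ q)].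

Lemma card_block j : #|blocks (pred1 j)| <= q.
Proof.
rewrite -[q in _ <= q]card_ord.
rewrite -(card_in_imset (f := fun x : 'I_(reduced_size b n) => inord (x %% q) : 'I_q)).
  exact: max_card.
move=> x y; rewrite !inE => /eqP xj /eqP yj /(congr1 val).
rewrite /= !inordK ?ltn_mod // => E; apply: val_inj.
by rewrite /= (divn_eq x q) (divn_eq y q) xj yj E.
Qed.

Lemma card_clause_blocks (C : {set 'I_n * bool}) k : #|C| <= k ->
  #|blocks [pred j | [exists l in C, j == l.1 %/ beta]]| <= k * q.
Proof.
move=> leC; apply: (@leq_trans (#|C| * q)); last by rewrite leq_mul2r leC orbT.
rewrite -sum_nat_const; apply: (@leq_trans (\sum_(l in C) #|blocks (pred1 (l.1 %/ beta))|)); last first.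
  by apply: leq_sum => l _; exact: card_block.
apply: leq_trans (leq_card_bigcup _ _); apply: subset_leq_card.
apply/fintype.subsetP=> x; rewrite inE => /existsP[l /andP[lC E]].
by apply/bigcupP; exists l; rewrite // inE.
Qed.

Lemma hitting_family_blocks S : S \in hitting_family ->
  S \subset blocks (pred1 (n %/ beta)) \/
  exists2 C, C \in F & S \subset blocks [pred j | [exists l in C, j == l.1 %/ beta]].
Proof.
rewrite inE => /mapP[s' s'L ->].
have memS x : x \in [set:: pmap insub s'] -> val x \in s'.
  by rewrite inE mem_pmap => /mapP[y ys E]; move: E; case: insubP => // i _ iy [->]; rewrite iy.
have [/allP all1 | [s sL /allP alls]] := reduced_family_blocks s'L; [left | right].
  by apply/fintype.subsetP=> x /memS/all1; rewrite inE.
exists [set:: s]; first by rewrite inE map_f.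
apply/fintype.subsetP=> x /memS/alls/hasP[l ls E]; rewrite inE.
by apply/existsP; exists l; rewrite inE ls.
Qed.

(** The list [L] may repeat clauses, so its length is no useful bound. Instead, each set lies within
    the at most [k] blocks of one clause of [F], or within the last block, and all subsets of these
    are counted. *)
Lemma hitting_family_sparse k : (forall C, C \in F -> #|C| <= k) ->
  #|hitting_family| <= 2 ^ q + #|F| * 2 ^ (k * q) /\
  forall S, S \in hitting_family -> #|S| <= k.+1 * q.
Proof.
move=> leF; split=> [|S /hitting_family_blocks[sS|[C CF sS]]]; last 2 first.
- by rewrite (leq_trans (subset_leq_card sS)) // (leq_trans (card_block _)) // leq_pmull.
- rewrite (leq_trans (subset_leq_card sS)) // mulSn.
  by rewrite (leq_trans (card_clause_blocks (leF _ CF))) // leq_addl.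
have sub : hitting_family \subset powerset (blocks (pred1 (n %/ beta))) :|:
    \bigcup_(C in F) powerset (blocks [pred j | [exists l in C, j == l.1 %/ beta]]).
  apply/fintype.subsetP=> S /hitting_family_blocks[sS|[C CF sS]]; rewrite inE powersetE.
    by rewrite sS.
  by apply/orP; right; apply/bigcupP; exists C; rewrite // powersetE.
apply: leq_trans (subset_leq_card sub) (leq_trans (leq_card_setU _ _) _).
apply: leq_add; first by rewrite card_powerset leq_pexp2l // card_block.
apply: leq_trans (leq_card_bigcup _ _) _; rewrite -sum_nat_const.
by apply: leq_sum => C CF; rewrite card_powerset leq_pexp2l // card_clause_blocks ?leF.
Qed.

Lemma leq_reduced_size : n <= reduced_size b n.
Proof.
rewrite {1}(divn_eq n beta) /reduced_size; have := ltn_pmod n (beta_gt0 b).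
by nia.
Qed.

End Bounds.

(** * The program *)

(** With [beta] a power of two, quotient and remainder of an index come from cutting its numeral.
    The result has exactly [k] entries, with zeros supplied, so that equal remainders give equal
    trees. *)
Fixpoint low_bits (k : nat) (t : tree) : tree :=
  if k is k'.+1 then Node (thd t) (low_bits k' (ttl t)) else Leaf.

Lemma FP_low_bits k f : FP f -> FP (fun x => low_bits k (f x)).
Proof.
elim: k f => [|k IHk] f ff /=; first exact: FP_const.
exact: FP_Node (FP_thd_of ff) (IHk _ (FP_ttl_of ff)).
Qed.

Lemma low_bits_nat_tree k i j :
  low_bits k (nat_tree i) = low_bits k (nat_tree j) <-> i = j %[mod 2 ^ k].
Proof.
elim: k i j => [|k IHk] i j; first by rewrite !modn1.
have modE m : m %% 2 ^ k.+1 = odd m + (m./2 %% 2 ^ k).*2.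
  have lt : m./2 %% 2 ^ k < 2 ^ k by rewrite ltn_mod expn_gt0.
  have {1}-> : m = m./2 %/ 2 ^ k * 2 ^ k.+1 + (odd m + (m./2 %% 2 ^ k).*2).
    rewrite -{1}(odd_double_half m) {1}(divn_eq m./2 (2 ^ k)) expnS doubleD.
    by rewrite addnCA mulnCA mul2n.
  by rewrite modnMDl modn_small // expnS; case: (odd m) => /=; lia.
rewrite !modE /= !thd_nat_tree !ttl_nat_tree; split.
  by case=> /bool_tree_inj-> /IHk->.
move=> E; have Eo : odd i = odd j by move/(congr1 odd): E; rewrite !oddD !odd_double !addbF !oddb.
rewrite Eo; congr Node; apply/IHk; move: E; rewrite Eo => /addnI.
by move/(congr1 half); rewrite !doubleK.
Qed.

Definition nat_bits (n : nat) : seq bool := map is_node (spine (nat_tree n)).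

Lemma nat_tree_bits n : nat_tree n = list_tree bool_tree (nat_bits n).
Proof.
rewrite /nat_bits; elim/ltn_ind: n => -[|n] // IHn.
rewrite (nat_tree_pos (ltn0Sn n)) /= is_node_bool_tree -IHn //.
by rewrite uphalfE -divn2; lia.
Qed.

Definition literal_bits n (l : 'I_n * bool) : seq bool := l.2 :: nat_bits l.1.

Lemma literal_tree_bits n (l : 'I_n * bool) :
  literal_tree l = list_tree bool_tree (literal_bits l).
Proof. by rewrite /literal_tree nat_tree_bits. Qed.

Lemma literal_bits_inj n : injective (@literal_bits n).
Proof.
move=> [i v] [j w] /(congr1 (list_tree bool_tree)).
by rewrite -!literal_tree_bits => -[/bool_tree_inj/= -> /nat_tree_inj/val_inj->].
Qed.

Definition sets_tree : seq (seq nat) -> tree := list_tree (list_tree nat_tree).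

Definition union_products_tree (X Y : tree) : tree :=
  flatmap_tree (fun u => flatmap_tree
    (fun v => Node (catrev_tree (thd v) (ttl v)) Leaf) (ttl u) (thd u)) Y X.

Lemma union_products_treeE X Y :
  union_products_tree (sets_tree X) (sets_tree Y) = sets_tree (union_products X Y).
Proof.
apply: flatmap_tree_list => x _ /=.
rewrite -[[seq catrev x y | y <- Y]]flatten_seq1 -map_comp.
by apply: flatmap_tree_list => y _ /=; rewrite catrev_tree_list.
Qed.

Lemma FP_union_products f g : FP f -> FP g ->
  FP (fun x => union_products_tree (f x) (g x)).
Proof.
move=> ff fg; apply: FP_flatmap fg ff; apply: FP_flatmap FP_ttl FP_thd.
exact: FP_Node (FP_catrev FP_thd FP_ttl) (FP_const _).
Qed.

Section Simulation.

Variable b : nat.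
Local Notation beta := (2 ^ b).
Local Notation p := (2 ^ b + b + 2).
Local Notation q := p.+1.

Variable enc : {set 'I_beta} -> {set 'I_p}.

Lemma FP_shift_sets : exists g, FP g /\ forall j t, bounded_sets b t ->
  g (Node (nat_tree j) (sets_tree t)) = sets_tree (shift_sets b j t).
Proof.
have [aff [faff affE]] := FP_affine (ltn0Sn p).
pose row u := Node (flatmap_tree (fun v => Node (aff v) Leaf) (thd u) (ttl u)) Leaf.
exists (fun z => flatmap_tree row (thd z) (ttl z)); split.
  apply: FP_flatmap FP_thd FP_ttl; apply: FP_Node (FP_const _).
  by apply: FP_flatmap FP_thd FP_ttl; exact: FP_Node faff (FP_const _).
move=> j t /allP bt /=; rewrite /shift_sets -[map _ t]flatten_seq1 -map_comp.
apply: flatmap_tree_list => s /bt/allP bs /=; congr (Node _ Leaf).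
rewrite -[[seq _ + e | e <- s]]flatten_seq1 -map_comp.
by apply: flatmap_tree_list => e /bs lte /=; rewrite affE // ltnW.
Qed.

Lemma FP_literal_sets : exists g, FP g /\ forall n (l : 'I_n * bool),
  g (literal_tree l) =
  sets_tree (shift_sets b (l.1 %/ beta) (literal_sets enc (block_literal b l).2)).
Proof.
have [sh [fsh shE]] := FP_shift_sets.
(* The sign heads the tree of a literal, so its first [b.+1] entries are the sign and the position
   of the variable inside its block. *)
pose key (l : bool * 'I_beta) := low_bits b.+1 (Node (bool_tree l.1) (nat_tree l.2)).
have key_inj : injective key.
  move=> [v i] [w j] [/bool_tree_inj/= -> /low_bits_nat_tree].
  by rewrite !modn_small // => /val_inj->.
have [tab [ftab tabE _]] := FP_finite (fun l => sets_tree (literal_sets enc l)) key_inj.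
exists (fun t => sh (Node (iter b ttl (ttl t)) (tab (low_bits b.+1 t)))); split.
  apply: FP_comp fsh (FP_Node (FP_iter_ttl _ FP_ttl) _).
  exact: FP_comp ftab (FP_low_bits _ FP_id).
move=> n [i v] /=; rewrite iter_ttl_nat_tree -shE ?literal_sets_bounded //.
rewrite -tabE /key /=; congr (sh (Node _ (tab (Node _ _)))).
by apply/low_bits_nat_tree; rewrite /= modn_mod.
Qed.

(** Unrolling the recursion [k] times keeps the program polynomial, although
    [clause_sets] is exponential in the number of literals; this is why the
    repeated literals of a clause have to be removed first. *)
Lemma FP_clause_sets k : exists g, FP g /\ forall n (D : seq ('I_n * bool)),
  size D <= k -> g (list_tree (@literal_tree n) D) =
  sets_tree (clause_sets enc [seq block_literal b l | l <- D]).
Proof.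
have [lit [flit litE]] := FP_literal_sets.
elim: k => [|k [g [fg gE]]].
  by exists (fun=> Node Leaf Leaf); split=> [|n []//]; exact: FP_const.
exists (fun t => if is_node t then union_products_tree (lit (thd t)) (g (ttl t))
                 else Node Leaf Leaf); split.
  apply: FP_if FP_id (FP_union_products _ _) (FP_const _).
    exact: FP_comp flit FP_thd.
  exact: FP_comp fg FP_ttl.
by move=> n [//|l D] /= leD; rewrite litE gE // union_products_treeE.
Qed.

Lemma FP_reduced_clause k : exists g, FP g /\ forall n (s : seq ('I_n * bool)),
  #|[set:: s]| <= k -> g (list_tree (@literal_tree n) s) = sets_tree (reduced_clause enc s).
Proof.
have [sh [fsh shE]] := FP_shift_sets; have [cl [fcl clE]] := FP_clause_sets k.
pose bl u := sh (Node (iter b ttl (ttl (ttl u))) (sets_tree (block_sets enc))).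
exists (fun t => catrev_tree (flatmap_tree bl Leaf t) (cl (undup_tree t))); split.
  apply: FP_catrev; last exact: FP_comp fcl (FP_undup FP_id).
  apply: FP_flatmap (FP_const _) FP_id; apply: FP_comp fsh (FP_Node _ (FP_const _)).
  exact: FP_iter_ttl (FP_ttl_of FP_ttl).
move=> n s les; rewrite /reduced_clause /sets_tree -catrev_tree_list; congr catrev_tree.
  apply: flatmap_tree_list => l _; rewrite /bl /= iter_ttl_nat_tree.
  exact/shE/block_sets_bounded.
have litE (D : seq ('I_n * bool)) : list_tree (@literal_tree n) D =
    list_tree (fun l => list_tree bool_tree (literal_bits l)) D.
  exact: eq_list_tree (@literal_tree_bits n).
rewrite litE undup_treeE; last exact: literal_bits_inj.
rewrite -litE clE // -(card_uniqP (rev_undup_uniq s)) (leq_trans _ les) //.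
by apply: subset_leq_card; apply/fintype.subsetP=> l; rewrite mem_rev_undup inE.
Qed.

Lemma FP_reduction k : exists g, FP g /\ forall n (L : seq (seq ('I_n * bool))),
    (forall s, s \in L -> #|[set:: s]| <= k) ->
  g (Node (nat_tree n) (list_tree (list_tree (@literal_tree n)) L)) =
  Node (nat_tree (reduced_size b n)) (sets_tree (reduced_family enc L)).
Proof.
have [aff [faff affE]] := FP_affine (ltn0Sn p).
have [sh [fsh shE]] := FP_shift_sets; have [cl [fcl clE]] := FP_reduced_clause k.
pose key (r : 'I_beta) := low_bits b (nat_tree r).
have key_inj : injective key.
  by move=> i j /low_bits_nat_tree; rewrite !modn_small // => /val_inj->.
have [tab [ftab tabE _]] := FP_finite (fun r : 'I_beta => sets_tree (padding_sets enc r)) key_inj.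
exists (fun w => Node (aff (Node (iter b ttl (thd w)) (nat_tree q)))
  (catrev_tree (sh (Node (iter b ttl (thd w)) (tab (low_bits b (thd w)))))
    (flatmap_tree (fun u => cl (ttl u)) Leaf (ttl w)))); split.
  have fblk : FP (fun w => iter b ttl (thd w)) by exact: FP_iter_ttl FP_thd.
  apply: FP_Node; first exact: FP_comp faff (FP_Node fblk (FP_const _)).
  apply: FP_catrev.
    apply: FP_comp fsh (FP_Node fblk _).
    exact: FP_comp ftab (FP_low_bits _ FP_thd).
  exact: FP_flatmap (FP_comp fcl FP_ttl) (FP_const _) FP_ttl.
move=> n L leL /=; rewrite iter_ttl_nat_tree affE // /reduced_size mulSn addnC.
congr Node; rewrite /reduced_family /sets_tree -catrev_tree_list; congr catrev_tree.
  have -> : low_bits b (nat_tree n) = key (bit_index b n).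
    by apply/low_bits_nat_tree; rewrite /= modn_mod.
  by rewrite tabE shE //; exact: padding_sets_bounded.
by apply: flatmap_tree_list => s /leL les /=; exact: clE.
Qed.

End Simulation.

(** * Comparison of the exponents *)

Lemma exec_cat p s r s' r' t z : exec p s r s' r' t -> exec p s (r ++ z) s' (r' ++ z) t.
Proof.
elim=> {p s r s' r' t}; try by move=> *; constructor.
- by move=> p1 p2 s1 s2 s3 r1 r2 r3 t u _ IH1 _ IH2; exact: exec_Seq IH1 IH2.
- by move=> e p s1 s2 s3 r1 r2 r3 t u en _ IH1 _ IH2; exact: exec_While_loop en IH1 IH2.
Qed.

Fixpoint clear (N : nat) : cmd :=
  if N is N'.+1 then Seq (clear N') (Assign N Nil) else Skip.

Lemma exec_clear N s r :
  exec (clear N) s r (fun y => if 0 < y <= N then Leaf else s y) r N.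
Proof.
elim: N => [|N IHN] /=.
  rewrite (_ : (fun y => _) = s); first exact: exec_Skip.
  by apply/funext => -[].
set s1 := (fun y => _) in IHN.
have := exec_Seq IHN (exec_Assign N.+1 Nil s1 r); rewrite addn1.
rewrite (_ : (fun y => _) = update s1 N.+1 (eval s1 Nil)) //.
apply/funext => y; rewrite /update /s1 /=; case: eqVneq => [->|ny]; first by rewrite leqnn.
by rewrite (leq_eqVlt y N.+1) (negPf ny).
Qed.

(** The time bound is also the number of coins, so the [U] steps of [pre] bring [U] coins that are
    ignored. Each bad outcome of the first [T] coins extends in [2 ^ U] ways, which leaves the error
    probability as it was. *)
Lemma decides_within_reduction (pre p : cmd) (w w' : tree) (U T : nat) (b : bool) :
    (forall r, exists2 u, exec pre (init w) r (init w') r u & u <= U) ->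
  decides_within p w' T b -> decides_within (Seq pre p) w (T + U) b.
Proof.
move=> ex_pre [out [run err]].
pose dT := nseq_tuple T false; pose dU := nseq_tuple U false.
pose fstT (r : (T + U).-tuple bool) : T.-tuple bool := insubd dT (take T r).
pose sndU (r : (T + U).-tuple bool) : U.-tuple bool := insubd dU (drop T r).
have fstE r : val (fstT r) = take T r.
  by rewrite insubdK // -topredE /= size_takel // size_tuple leq_addr.
have sndE r : val (sndU r) = drop T r.
  by rewrite insubdK // -topredE /= size_drop size_tuple addKn.
exists (fun r => out (fstT r)); split=> [r|].
  have [s [r' [t [ex le ans]]]] := run (fstT r).
  have [u ex_u le_u] := ex_pre r.
  exists s, (r' ++ drop T r), (u + t); split=> //; last by rewrite addnC leq_add.
  apply: exec_Seq ex_u _; rewrite -{1}(cat_take_drop T r) -fstE; exact: exec_cat.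
set A := [pred r | _]; pose B := [pred r : T.-tuple bool | out r != b].
have leAB : #|A| <= #|B| * 2 ^ U.
  have <- : #|{: U.-tuple bool}| = 2 ^ U by rewrite card_tuple card_bool.
  have <- : #|[pred x : T.-tuple bool * U.-tuple bool | x.1 \in B]| =
      #|B| * #|{: U.-tuple bool}|.
    by rewrite -cardX; apply: eq_card => x; rewrite !inE andbT.
  have inj : injective (fun r => (fstT r, sndU r)).
    move=> r1 r2 [/(congr1 val) + /(congr1 val)]; rewrite !fstE !sndE => E1 E2.
    by apply: val_inj; rewrite /= -(cat_take_drop T r1) E1 E2 cat_take_drop.
  rewrite -(card_image inj); apply: subset_leq_card; apply/fintype.subsetP => x.
  by case/imageP => r rA ->.
by rewrite expnD (leq_trans (leq_mul (leqnn 3) leAB)) // mulnA leq_mul.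
Qed.

(** The reduction clears its workspace, so that the second program starts in
    the store [init (g w)]. *)
Lemma FP_program g : FP g -> exists pre (T : tree -> nat), poly_bounded T /\
  forall w r, exists2 u, exec pre (init w) r (init (g w)) r u & u <= T w.
Proof.
move=> [T [[N cg] bT _]]; have [p cp] := cg 0.
exists (Seq p (clear N)), (fun w => T w + N); split.
  exact: poly_bounded_add bT (poly_bounded_const _).
move=> w r; have [s [t [ex le s0 fr]]] := cp (init w) r w erefl.
exists (t + N); last by rewrite leq_add2r.
apply: exec_Seq ex _.
rewrite (_ : init _ = fun y => if 0 < y <= N then Leaf else s y); first exact: exec_clear.
apply/funext => y; rewrite /init /update; case: eqVneq => [->|ny]; first by rewrite s0.
rewrite lt0n ny /=; case: leqP => // ltN.
rewrite fr; last by rewrite add0n (ltnW ltN) orbT.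
by rewrite /init /update (negPf ny).
Qed.

Lemma reduction_code b : exists enc : {set 'I_(2 ^ b)} -> {set 'I_(2 ^ b + b + 2)},
  injective enc /\ forall x y, #|enc x| = #|enc y|.
Proof.
(* After cancelling [2 ^ (2 ^ b)] the requirement is [2 ^ b + b + 3 <= 4 * 2 ^ b], which follows
   from [b < 2 ^ b]; this is the origin of the summand [b + 2]. *)
apply: constant_weight_code; rewrite -addnA [in leqRHS]expnD mulnC leq_mul2l.
apply/orP; right; have := ltn_expl b (ltnSn 1).
by rewrite expnD; lia.
Qed.

Lemma satisfies_list n (L : seq (seq ('I_n * bool))) a :
  satisfies a [set:: [seq [set:: s] | s <- L]] =
  all (has (fun l : 'I_n * bool => a l.1 == l.2)) L.
Proof.
have hasE (s : seq ('I_n * bool)) :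
    [exists l in [set:: s], a l.1 == l.2] = has (fun l => a l.1 == l.2) s.
  by apply/exists_inP/hasP => -[l]; rewrite ?inE => ls al; exists l; rewrite ?inE.
apply/forall_inP/allP => [sat s sL | sat C].
  by rewrite -hasE; apply: sat; rewrite inE map_f.
by rewrite inE => /mapP[s sL ->]; rewrite hasE; exact: sat.
Qed.

Local Open Scope ring_scope.

Section Exponents.

Variable R : realType.

Definition block_ratio (b : nat) : R := (2 ^ b + b + 3)%N%:R / (2 ^ b)%N%:R.

Lemma block_ratio_gt0 b : 0 < block_ratio b.
Proof. by rewrite divr_gt0 // ltr0n ?expn_gt0 // addn3. Qed.

Definition set_size_bound (b k : nat) : nat := (k.+1 * (2 ^ b + b + 3))%N.

(** The first summand pays for the last block. The absolute value keeps the bound nonnegative when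
    [c] is negative, so that summing such bounds gives a monotone function. *)
Definition density_bound (b k : nat) (c : R) : R :=
  (2 ^ (2 ^ b + b + 3))%N%:R + `|c| * (2 ^ (k * (2 ^ b + b + 3)))%N%:R.

Lemma density_bound_ge0 b k c : 0 <= density_bound b k c.
Proof. by rewrite addr_ge0 // mulr_ge0. Qed.

Lemma sparse_hitting_family b (enc : {set 'I_(2 ^ b)} -> {set 'I_(2 ^ b + b + 2)})
    k c c' n (L : seq (seq ('I_n * bool))) :
    density_bound b k c <= c' ->
    sparse n k c ([set:: [seq [set:: s] | s <- L]] : cnf n) ->
  sparse (reduced_size b n) (set_size_bound b k) c' (hitting_family enc L).
Proof.
move=> le_c' [leF /(hitting_family_sparse enc)[leF' leS]].
have qE : (2 ^ b + b + 3 = (2 ^ b + b + 2).+1)%N by rewrite addnS.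
split; last by move=> S SF; rewrite /set_size_bound qE; exact: leS.
(* Positive even for [n = 0], so the constant number of sets in the last block is absorbed by the
   density. *)
have sz_gt0 : (0 < reduced_size b n)%N by [].
rewrite -(ler_nat R) natrD natrM in leF'; apply: le_trans leF' _.
apply: le_trans (_ : density_bound b k c * (reduced_size b n)%:R <= _); last first.
  by rewrite ler_wpM2r.
rewrite /density_bound qE mulrDl lerD //; first by rewrite ler_peMr // ler1n.
rewrite mulrAC ler_wpM2r //; apply: le_trans leF _.
apply: le_trans (_ : `|c| * n%:R <= _); first by rewrite ler_wpM2r // ler_norm.
by rewrite ler_wpM2l // ler_nat leq_reduced_size.
Qed.

Lemma reduced_size_ratio b n (eps : R) : 0 <= eps ->
  eps * (reduced_size b n)%:R <= eps * block_ratio b * n%:R + eps * (2 ^ b + b + 3)%N%:R.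
Proof.
move=> eps_ge0; rewrite -mulrA -mulrDr ler_wpM2l //.
have -> : reduced_size b n = (n %/ 2 ^ b * (2 ^ b + b + 3) + (2 ^ b + b + 3))%N.
  by rewrite /reduced_size -addnS mulSn addnC.
rewrite natrD lerD2r natrM mulrC /block_ratio -mulrA ler_wpM2l //.
by rewrite ler_pdivlMl ?ltr0n ?expn_gt0 // -natrM ler_nat mulnC leq_divM.
Qed.

Lemma solvable_cnf b k (c c' eps : R) : 0 <= eps -> density_bound b k c <= c' ->
    solvable_with_exponent (sparse_parity_hitting_set (set_size_bound b k) c') eps ->
  solvable_with_exponent (sparse_parity_cnf_sat k c) (eps * block_ratio b).
Proof.
move=> eps_ge0 le_c' [p [C [d solve]]].
have [enc [enc_inj enc_card]] := reduction_code b.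
have [g [fg gE]] := FP_reduction enc k.
have [pre [U [[C1 [d1 leU]] ex_pre]]] := FP_program fg.
have [_ [_ _ [C2 [d2 le_g]]]] := fg.
(* The last block adds [2 ^ b + b + 3] elements whatever [n] is; [K] absorbs the resulting constant
   factor in the running time. *)
pose K := (Num.trunc (2 `^ (eps * (2 ^ b + b + 3)%N%:R) : R)).+1.
exists (Seq pre p), (C1 + K * (C * C2 ^ d))%N, (d1 + d2 * d)%N.
move=> [n [F sF]] w enc_w.
have {enc_w} [L [FE wE]] : encodes_family (@literal_tree n) n F w := enc_w.
rewrite [parameter _]/= [answer _]/=; subst F; have sF' := sparse_hitting_family enc le_c' sF.
have gw : g w = Node (nat_tree (reduced_size b n))
    (list_tree (list_tree nat_tree) (reduced_family enc L)).
  by rewrite wE gE // => s sL; apply: sF.2; rewrite inE map_f.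
have [] := solve (existT _ (reduced_size b n) (exist _ (hitting_family enc L) sF')) (g w).
  by rewrite /= gw; exact: encodes_hitting_family.
move=> T /= [leT dec]; exists (T + U w)%N; split; last first.
  apply: decides_within_reduction (ex_pre w) _.
  rewrite (_ : odd _ = odd #|[pred H | hits H (hitting_family enc L)]|) //.
  rewrite (eq_card (B := [pred a : {ffun 'I_n -> bool} | all (has (fun l : 'I_n * bool => a l.1 == l.2)) L])).
    rewrite -(reduced_family_parity enc_inj enc_card); congr odd.
    by apply: eq_card => H; rewrite !inE hits_hitting_family.
  by move=> a; rewrite !inE satisfies_list.
set X := 2 `^ (eps * block_ratio b * n%:R).
have X_ge1 : 1 <= X.
  rewrite -[1](powRr0 (2 : R)) ler_powR // ?ler1n //.
  by rewrite !mulr_ge0 // ltW // block_ratio_gt0.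
have leX : 2 `^ (eps * (reduced_size b n)%:R) <= X * K%:R.
  apply: le_trans (_ : X * 2 `^ (eps * (2 ^ b + b + 3)%N%:R) <= _).
    rewrite -powRD; last by rewrite pnatr_eq0 implybT.
    by rewrite ler_powR ?ler1n // reduced_size_ratio.
  by rewrite ler_wpM2l ?powR_ge0 // ltW // truncnS_gt.
have w_gt0 := tree_size_gt0 w.
have leT' : (T%:R : R) <= X * (K * (C * C2 ^ d) * tree_size w ^ (d1 + d2 * d))%N%:R.
  apply: le_trans leT _; apply: le_trans (ler_wpM2r (ler0n _ _) leX) _.
  rewrite -mulrA -natrM ler_wpM2l ?powR_ge0 // ler_nat -!mulnA leq_mul2l; apply/orP; right.
  rewrite leq_mul2l; apply/orP; right.
  apply: leq_trans (leq_expl d (le_g w)) _; rewrite expnMn -expnM leq_mul2l.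
  by rewrite leq_pexp2l ?orbT // leq_addl.
have leU' : ((U w)%:R : R) <= X * (C1 * tree_size w ^ (d1 + d2 * d))%N%:R.
  apply: le_trans (_ : (C1 * tree_size w ^ (d1 + d2 * d))%N%:R <= _).
    by rewrite ler_nat (leq_trans (leU w)) // leq_mul2l leq_pexp2 ?orbT.
  by rewrite ler_peMl.
by rewrite natrD mulnDl natrD mulrDr addrC lerD.
Qed.

Lemma sigma_cnf_le b k (c c' : R) : density_bound b k c <= c' ->
  (sigma R (sparse_parity_cnf_sat k c) <=
   (block_ratio b)%:E * sigma R (sparse_parity_hitting_set (set_size_bound b k) c'))%E.
Proof.
move=> le_c'; rewrite -lee_pdivrMl ?block_ratio_gt0 //.
apply: le_ereal_inf_tmp => _ [eps [eps_gt0 solv] <-].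
rewrite lee_pdivrMl ?block_ratio_gt0 // -EFinM mulrC.
apply: ereal_inf_lbound; exists (eps * block_ratio b) => //; split.
  by rewrite mulr_gt0 ?block_ratio_gt0.
exact: solvable_cnf (ltW eps_gt0) le_c' solv.
Qed.

Lemma sigma_hitting_set_le k k' (c c' : R) : (k <= k')%N -> c <= c' ->
  (sigma R (sparse_parity_hitting_set k c) <= sigma R (sparse_parity_hitting_set k' c'))%E.
Proof.
move=> lek lec; apply: ereal_inf_le_tmp => _ [eps [eps_gt0 [p [C [d solve]]]] <-].
exists eps => //; split=> //; exists p, C, d => -[n [F [leF leS]]] w enc_w.
have sF : sparse n k' c' F.
  split=> [|S /leS leSk]; last exact: leq_trans lek.
  by apply: (le_trans leF); rewrite ler_wpM2r.
exact: (solve (existT _ n (exist _ F sF))).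
Qed.

(** * Passage to the limit *)

Lemma cvg_block_ratio : (block_ratio k @[k --> \oo] --> (1 : R))%classic.
Proof.
(* As [harmonic k] is [1 / k.+1], the upper bound amounts to [(k + 3) * (k + 1) <= 8 * 2 ^ k], an
   induction. *)
apply: (@squeeze_cvgr _ _ _ _ (fun=> 1) (fun k => 1 + 8 * harmonic k)).
- apply: nearW => k.
  have ne0 : (2 ^ k)%N%:R != 0 :> R by rewrite pnatr_eq0 -lt0n expn_gt0.
  have pos : 0 < (2 ^ k)%N%:R :> R by rewrite ltr0n expn_gt0.
  rewrite /block_ratio -addnA natrD mulrDl divff //; apply/andP; split.
    by rewrite lerDl divr_ge0.
  rewrite lerD2l ler_pdivrMr // /harmonic /= mulrAC ler_pdivlMr ?ltr0n //.
  rewrite -[8]/(8%:R) -!natrM ler_nat.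
  elim: k {ne0 pos} => // k IHk; rewrite expnS; nia.
- exact: cvg_cst.
- have : ((1 + 8 * harmonic k) @[k --> \oo] --> (1 + 8 * 0 : R))%classic.
    by apply: cvgD; [exact: cvg_cst | apply: cvgM; [exact: cvg_cst | exact: cvg_harmonic]].
  by rewrite mulr0 addr0.
Qed.

(** For an arbitrary density function no monotonicity in [k] is at hand on the CNF side, whence the
    upper limit. Only finite [l] needs an argument: [+oo] bounds everything and the sign excludes
    [-oo]. *)
Lemma limn_esup_le_mul (u : nat -> \bar R) (r : nat -> R) (l : \bar R) :
    (r k @[k --> \oo] --> (1 : R))%classic -> (forall k, 0 <= r k) ->
    (forall k, u k <= (r k)%:E * l)%E -> (0 <= l)%E ->
  (limn_esup u <= l)%E.
Proof.
move=> cvr r_ge0 leu; case: l leu => [l| |] // leu l_ge0; last exact: leey.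
have cv : (((r k)%:E * l%:E)%E @[k --> \oo] --> l%:E)%classic.
  have : (((r k)%:E * l%:E)%E @[k --> \oo] --> (1%:E * l%:E)%E)%classic.
    by apply: cvgeZr => //; apply: cvg_EFin => //; exact: nearW.
  by rewrite mul1e.
rewrite -(cvg_limn_einf_sup cv).2 !limn_esup_lim.
apply: lee_lim; [exact: is_cvg_esups | exact: is_cvg_esups | apply: nearW => n].
apply: ge_ereal_sup => _ [k /= nk <-]; apply: le_ereal_sup_tmp.
by exists ((r k)%:E * l%:E)%E; first by exists k.
Qed.

End Exponents.

Theorem theorem11 (R : realType) (c : nat -> R) :
  exists c' : nat -> R,
    let sigma_cnf := fun k : nat =>
      sigma R (sparse_parity_cnf_sat k (c k)) in
    let sigma_hs := fun k' : nat =>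
      sigma R (sparse_parity_hitting_set k' (c' k')) in
    cvgn sigma_hs /\ (limn_esup sigma_cnf <= limn sigma_hs)%E.
Proof.
(* Partial sums of nonnegative terms are monotone and dominate each term. Since
   [k <= set_size_bound k k], the sum up to the latter includes the bound for [k], and
   [set_size_bound] need not be inverted. *)
pose c' (x : nat) : R := \sum_(k < x.+1) density_bound k k (c k).
have c'_mono : {homo c' : x y / (x <= y)%N >-> x <= y}.
  apply: homo_leq => [x|y x z|x]; [exact: lexx | exact: le_trans|].
  by rewrite /c' [leRHS]big_ord_recr /= lerDl density_bound_ge0.
have c'_large k : density_bound k k (c k) <= c' (set_size_bound k k).
  apply: le_trans (c'_mono k _ _); last first.
    by rewrite /set_size_bound addn3 mulSn; lia.
  by rewrite /c' big_ord_recr /= lerDr sumr_ge0 // => i _; exact: density_bound_ge0.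
exists c' => sigma_cnf sigma_hs.
have hs_mono : {homo sigma_hs : x y / (x <= y)%N >-> (x <= y)%E}.
  by move=> x y lexy; apply: sigma_hitting_set_le => //; exact: c'_mono.
have cv := ereal_nondecreasing_cvgn hs_mono.
split; first exact: ereal_nondecreasing_is_cvgn.
have -> : limn sigma_hs = ereal_sup (range sigma_hs) by exact: cvg_lim cv.
have hs_ge0 x : (0 <= sigma_hs x)%E.
  by apply: le_ereal_inf_tmp => _ [eps [eps_gt0 _] <-]; rewrite lee_fin ltW.
have hs_le x : (sigma_hs x <= ereal_sup (range sigma_hs))%E.
  by apply: ereal_sup_ubound; exists x.
apply: (limn_esup_le_mul (@cvg_block_ratio R)).
- by move=> k; rewrite ltW // block_ratio_gt0.
- move=> k; apply: le_trans (sigma_cnf_le (c'_large k)) _.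
  by rewrite lee_pmul2l ?lte_fin ?block_ratio_gt0 //; exact: hs_le.
- exact: le_trans (hs_ge0 0) (hs_le 0).
Qed.
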